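(* Let $$E(u)=\int_{B_r}k^2|u_{,R}|^2+|u_{,\tau}|^2\,dx .$$ The map $\bar u(R,\theta)=k^{-1/2}R\,e_R(k\theta)$ solves the Euler–Lagrange equation associated with $E$, i.e. $u=\bar u$ satisfies $$\int_{B_r}u_{,\tau}\cdot\varphi_{,\tau}+k^2u_{,R}\cdot\varphi_{,R}\,dx=0\quad\forall\varphi\in C_c^\infty(B_r,\mathbb{R}^2).$$ Consequently, $\bar u$ is the unique global minimizer of $E$ in the class $\mathcal{A}_2$.
   Context: $B_r$ is the ball with centre $0$ and radius $r>0$ in $\mathbb{R}^2$, $(R,\theta)$ are plane polar coordinates, $R=|x|$, $e_R(\theta)=(\cos\theta,\sin\theta)^T$; $u_{,R}$ and $u_{,\theta}$ are partial derivatives with respect to $R$ and $\theta$, and $u_{,\tau}=\frac1Ru_{,\theta}$. $k\ge2$ is an integer. The class is $$\mathcal{A}_2=\{u\in W^{1,2}(B_r;\mathbb{R}^2):\ u=\bar u\text{ on }\partial B_r,\ G(u)\in(-\infty,+\infty)\},\qquad G(u)=\int_{B_r}\gamma(\nabla u)+\lambda\ln R\,\det\nabla u\,dx,$$ where $\gamma(F)=f(|F|)$, $|F|^2=\mathrm{tr}(F^TF)$, $f:[0,\infty)\to\mathbb{R}$ is $C^2$ on $(0,\infty)$ with $f''>0$ there, $D\gamma(0)$ exists, $\gamma(F)\ge\gamma(0)=0$ for all $F\in\mathbb{R}^{2\times 2}$, $c_1|F|^2\le\gamma(F)\le c_2(1+|F|^2)$ for all $F\in\mathbb{R}^{2\times2}$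 with constants $c_1,c_2>0$, and $\lambda=\frac{(k^2-1)f'(t)}{kt}$ with $t=k^{-1/2}(1+k^2)^{1/2}$. Uniqueness is as elements of $W^{1,2}$ (equality a.e. in $B_r$). *)

(* Defs.v *)
From HB Require Import structures.
From mathcomp Require Import all_boot all_order all_algebra.
From mathcomp Require Import all_classical all_reals all_analysis.

Set Implicit Arguments.
Unset Strict Implicit.
Unset Printing Implicit Defensive.

Import Order.TTheory GRing.Theory Num.Theory.
Import numFieldNormedType.Exports.

Local Open Scope classical_set_scope.
Local Open Scope ring_scope.

(* Points of the plane are pairs, because R * R carries both the product
   Lebesgue measure and the normed structure used by 'D_v; values are columns
   'cV_2 and gradients are 2 x 2 matrices.  The library norms on R * R and on
   matrices are sup norms, so the Euclidean ones are defined here. *)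

Notation plane_measure R := (@lebesgue_measure R \x @lebesgue_measure R)%E.

Section plane.
Variable R : realType.

Definition cvec (a b : R) : 'cV[R]_2 := \col_i (if i == ord0 then a else b).

Definition base (j : 'I_2) : R * R := if j == ord0 then (1, 0) else (0, 1).

Definition mxdot (m n : nat) (A B : 'M[R]_(m, n)) : R := \tr (A^T *m B).

Definition mxnorm (m n : nat) (A : 'M[R]_(m, n)) : R := Num.sqrt (mxdot A A).

Definition radius (x : R * R) : R := mxnorm (cvec x.1 x.2).

(* The polar angle in ]-pi, pi]; see [polarE]. *)
Definition angle (x : R * R) : R :=
  if 0 <= x.2 then acos (x.1 / radius x) else - acos (x.1 / radius x).

Definition eR (theta : R) : 'cV[R]_2 := cvec (cos theta) (sin theta).

Definition etau (theta : R) : 'cV[R]_2 := cvec (- sin theta) (cos theta).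

Lemma radiusE (x : R * R) : radius x = Num.sqrt (x.1 ^+ 2 + x.2 ^+ 2).
Proof.
rewrite /radius /mxnorm /mxdot /mxtrace big_ord1 !mxE !big_ord_recl big_ord0.
by rewrite !mxE /= addr0 !expr2.
Qed.

Lemma polarE (x : R * R) : cvec x.1 x.2 = radius x *: eR (angle x).
Proof.
have r2 : radius x ^+ 2 = x.1 ^+ 2 + x.2 ^+ 2.
  by rewrite radiusE sqr_sqrtr// addr_ge0// sqr_ge0.
have r0 : 0 <= radius x by rewrite sqrtr_ge0.
have [rx0|rn0] := eqVneq (radius x) 0.
  have /eqP : x.1 ^+ 2 + x.2 ^+ 2 = 0 by rewrite -r2 rx0 expr0n.
  rewrite paddr_eq0 ?sqr_ge0// !sqrf_eq0 => /andP[/eqP -> /eqP ->].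
  by rewrite rx0 scale0r; apply/colP => i; rewrite !mxE if_same.
have rgt0 : 0 < radius x by rewrite lt_neqAle eq_sym rn0.
have q1 : (x.1 / radius x) ^+ 2 <= 1.
  rewrite expr_div_n ler_pdivrMr ?exprn_gt0// mul1r r2.
  by rewrite lerDl sqr_ge0.
have qB : -1 <= x.1 / radius x <= 1.
  by rewrite -ler_norml -(@ler_pXn2r _ 2)// ?nnegrE// expr1n real_normK ?num_real.
have cE : cos (angle x) = x.1 / radius x.
  rewrite /angle; case: ifP => _; rewrite ?cosN acosK// in_itv/=.
have sE : radius x * sin (acos (x.1 / radius x)) = `|x.2|.
  rewrite sin_acos// -sqrtr_sqr -{1}(gtr0_norm rgt0) -sqrtr_sqr -sqrtrM ?sqr_ge0//.
  congr Num.sqrt; rewrite expr_div_n mulrBr mulr1 mulrCA divff ?mulr1 ?expf_neq0//.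
  by rewrite r2 [x.1 ^+ 2 + _]addrC addrK.
apply/colP => i; rewrite !mxE; case: ifP => _; first by rewrite cE mulrC divfK.
rewrite /angle; case: (leP 0 x.2) => x20; rewrite ?sinN ?mulrN sE.
  by rewrite ger0_norm.
by rewrite ltr0_norm// opprK.
Qed.

Definition disk (r : R) : set (R * R) := [set x | radius x < r].

(* C^n regularity on the whole plane, through continuous iterated partials. *)
Fixpoint isC (n : nat) (phi : R * R -> R) : Prop :=
  continuous phi /\
  if n is m.+1 then
    (forall j x, derivable phi x (base j)) /\
    (forall j, isC m (fun x => 'D_(base j) phi x))
  else True.

(* C_c^infty(U), each function being extended by 0 to the plane. *)
Definition test_fun (U : set (R * R)) (phi : R * R -> R) : Prop :=
  [/\ forall n, isC n phi,
      compact (closure [set x | phi x != 0]) &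
      closure [set x | phi x != 0] `<=` U].

Definition test_field (U : set (R * R)) (phi : R * R -> 'cV[R]_2) : Prop :=
  forall i, test_fun U (fun x => phi x i ord0).

Definition classical_grad (phi : R * R -> 'cV[R]_2) (x : R * R) : 'M[R]_2 :=
  \matrix_(i, j) 'D_(base j) (fun y => phi y i ord0) x.

(* Measurability is Borel measurability: every L^2 class has such a
   representative. *)
Definition inL2 (U : set (R * R)) (g : R * R -> R) : Prop :=
  measurable_fun U g /\
  (plane_measure R).-integrable U (fun x => (g x ^+ 2)%:E).

Definition weak_partial (U : set (R * R)) (j : 'I_2) (v g : R * R -> R) : Prop :=
  forall phi, test_fun U phi ->
    (\int[plane_measure R]_(x in U) (v x * 'D_(base j) phi x)%:E =
     - \int[plane_measure R]_(x in U) (g x * phi x)%:E)%E.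

Definition is_weak_grad (U : set (R * R)) (u : R * R -> 'cV[R]_2)
    (Du : R * R -> 'M[R]_2) : Prop :=
  forall i j, inL2 U (fun x => Du x i j) /\
    weak_partial U j (fun x => u x i ord0) (fun x => Du x i j).

Definition W12 (U : set (R * R)) (u : R * R -> 'cV[R]_2) : Prop :=
  (forall i, inL2 U (fun x => u x i ord0)) /\ exists Du, is_weak_grad U u Du.

(* A chosen representative; it is determined up to a null set of U. *)
Definition grad (U : set (R * R)) (u : R * R -> 'cV[R]_2) : R * R -> 'M[R]_2 :=
  xget (fun=> 0) [set Du | is_weak_grad U u Du].

(* W_0^{1,2}(U): the closure of C_c^infty(U) in the W^{1,2} norm. *)
Definition W012 (U : set (R * R)) (v : R * R -> 'cV[R]_2) : Prop :=
  W12 U v /\ exists phi : nat -> R * R -> 'cV[R]_2,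
    (forall n, test_field U (phi n)) /\
    (\int[plane_measure R]_(x in U)
       (mxnorm (v x - phi n x) ^+ 2 +
        mxnorm (grad U v x - classical_grad (phi n) x) ^+ 2)%:E)%E
      @[n --> \oo] --> 0%E.

(* u_{,R} and u_{,tau} = u_{,theta} / R, read off a gradient field Du: by the
   chain rule they are its values in the orthonormal directions e_R, e_theta. *)
Definition dR (Du : R * R -> 'M[R]_2) (x : R * R) : 'cV[R]_2 :=
  Du x *m eR (angle x).

Definition dtau (Du : R * R -> 'M[R]_2) (x : R * R) : 'cV[R]_2 :=
  Du x *m etau (angle x).

Definition ubar (k : nat) (x : R * R) : 'cV[R]_2 :=
  ((Num.sqrt k%:R)^-1 * radius x) *: eR (k%:R * angle x).

Definition gamma (f : R -> R) (F : 'M[R]_2) : R := f (mxnorm F).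

Definition tk (k : nat) : R := (Num.sqrt k%:R)^-1 * Num.sqrt (1 + k%:R ^+ 2).

Definition lambda (f : R -> R) (k : nat) : R :=
  (k%:R ^+ 2 - 1) * derive1 f (tk k) / (k%:R * tk k).

(* The library sets +oo - oo = -oo, so that this is finite exactly when the
   (measurable) integrand is Lebesgue integrable. *)
Definition G (f : R -> R) (k : nat) (r : R) (u : R * R -> 'cV[R]_2) : \bar R :=
  (\int[plane_measure R]_(x in disk r)
     (gamma f (grad (disk r) u x) +
      lambda f k * ln (radius x) * \det (grad (disk r) u x))%:E)%E.

(* The boundary condition is understood as u - ubar \in W_0^{1,2}. *)
Definition A2 (f : R -> R) (k : nat) (r : R) : set (R * R -> 'cV[R]_2) :=
  [set u | [/\ W12 (disk r) u,
               W012 (disk r) (fun x => u x - ubar k x) &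
               (-oo < G f k r u < +oo)%E]].

Definition E (k : nat) (r : R) (u : R * R -> 'cV[R]_2) : \bar R :=
  (\int[plane_measure R]_(x in disk r)
     (k%:R ^+ 2 * mxnorm (dR (grad (disk r) u) x) ^+ 2 +
      mxnorm (dtau (grad (disk r) u) x) ^+ 2)%:E)%E.

Definition global_minimizer (J : (R * R -> 'cV[R]_2) -> \bar R)
    (A : set (R * R -> 'cV[R]_2)) (u : R * R -> 'cV[R]_2) : Prop :=
  A u /\ forall v, A v -> (J u <= J v)%E.

End plane.

(* Main.v *)
Require Import Defs.
From mathcomp Require Import all_boot all_order all_algebra.
From mathcomp Require Import all_classical all_reals all_analysis.
From mathcomp Require Import measurable_realfun ring lra.

(** Away from the origin the gradient A of [ubar] sends the frame vectors e_R
    and e_theta at the polar angle theta to k^(-1/2) e_R(k theta) and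
    k^(1/2) e_theta(k theta).  Weighting the radial part of A by k^2 therefore
    gives k times the cofactor matrix of A ([Qform_gradubarE]).  The rows of a
    cofactor matrix are gradients turned by a right angle, hence they are
    divergence free, and the Euler-Lagrange equation of E at [ubar] holds.  In
    the weak form this costs no regularity of [ubar] at the origin: the
    derivative is moved from [ubar] to the test function, whose mixed partial
    derivatives commute ([weak_curl_free], [euler_lagrange]).

    E is quadratic, so E(u) is E(ubar), plus E(u - ubar), plus a cross term
    between [ubar] and u - ubar.  The cross term vanishes on test fields by the
    Euler-Lagrange equation and on W_0^{1,2} by density
    ([Qform_W012_orthogonal]).  Hence E(u) = E(ubar) + E(u - ubar)
    ([E_decomposition]): [ubar] minimises, and another minimiser has
    E(u - ubar) = 0, which by the Poincare inequality on W_0^{1,2}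
    ([W012_poincare]) forces u = ubar almost everywhere.

    Two things have to be checked before this applies.  The energy is built on a
    chosen weak gradient, so weak gradients must be unique up to null sets
    ([weak_grad_unique]); this is the fundamental lemma of the calculus of
    variations ([ae_eq0_of_tests]), tested on smooth bumps that converge to the
    indicators of boxes.  And [ubar] must lie in the class: it is C^1 along every
    line parallel to an axis that misses the origin, which by Fubini gives its
    weak gradient ([weak_grad_ubar]); this gradient has constant norm and
    determinant 1, so that G(ubar) is finite because ln R is integrable on the
    disk ([G_fin_num]). *)

Import Order.TTheory GRing.Theory Num.Theory.
Import numFieldNormedType.Exports.

Set Implicit Arguments.
Unset Strict Implicit.
Unset Printing Implicit Defensive.

Local Open Scope classical_set_scope.
Local Open Scope ring_scope.

(* [radius] is also the radius of a ball in the theory of coverings. *)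
Local Notation radius := Defs.radius.

(** * Lines parallel to the axes, and measurability of open sets *)

Section plane_topology.
Variable R : realType.
Implicit Types (f : R * R -> R) (x : R * R).
Notation mu := (plane_measure R).

(** The two families of lines parallel to the axes in one notation: the line
    [pt j _ s] runs in the direction [base R j], so that a statement about both
    partial derivatives is proved once. *)
Definition pt (j : 'I_2) (t s : R) : R * R := if j == ord0 then (t, s) else (s, t).

Lemma pt_fst x : pt ord0 x.1 x.2 = x.
Proof. by case: x. Qed.

Lemma pt_snd x : pt ord_max x.2 x.1 = x.
Proof. by case: x. Qed.

Lemma ptP j x : exists t s, x = pt j t s.
Proof.
have [->|->] : j = ord0 \/ j = ord_max.
  by case: j => -[|[|//]] ?; [left|right]; exact: val_inj.
- by exists x.1, x.2; rewrite pt_fst.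
- by exists x.2, x.1; rewrite pt_snd.
Qed.

(** The difference quotients of [f] in the direction [base R j] are those of
    its restriction to a line, which reduces partial derivatives to the calculus
    of one variable. *)
Lemma line_quot j f t s :
  (fun h : R => h^-1 *: ((f \o shift (pt j t s)) (h *: base R j) - f (pt j t s))) =
  (fun h : R => h^-1 *: (((fun t => f (pt j t s)) \o shift t) (h *: 1) - f (pt j t s))).
Proof.
apply/funext => h /=; congr (_ *: (f _ - _)); rewrite /pt /base.
by case: ifP => _; apply: injective_projections => /=; rewrite ?scaler0 ?add0r.
Qed.

Lemma derivable_line j f t s :
  derivable f (pt j t s) (base R j) = derivable (fun t => f (pt j t s)) t 1.
Proof. by rewrite /derivable line_quot. Qed.

Lemma derive_line j f t s :
  'D_(base R j) f (pt j t s) = 'D_1 (fun t => f (pt j t s)) t.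
Proof. by rewrite /derive line_quot. Qed.

Lemma is_derive_line j f (t s d : R) :
  is_derive t 1 (fun t => f (pt j t s)) d -> is_derive (pt j t s) (base R j) f d.
Proof.
by move=> [h1 h2]; split; [rewrite derivable_line|rewrite derive_line].
Qed.

Lemma continuous_pt j s : continuous (fun t => pt j t s).
Proof.
move=> t; rewrite /pt; case: (j == ord0).
  exact: (cvg_pair (@cvg_id _ (nbhs t)) (@cvg_cst _ s _ (nbhs t) _)).
exact: (cvg_pair (@cvg_cst _ s _ (nbhs t) _) (@cvg_id _ (nbhs t))).
Qed.

Definition ratbox (q : (rat * rat) * (rat * rat)) : set (R * R) :=
  `]ratr q.1.1, ratr q.1.2[ `*` `]ratr q.2.1, ratr q.2.2[.

Definition cratbox (q : (rat * rat) * (rat * rat)) : set (R * R) :=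
  `[ratr q.1.1, ratr q.1.2] `*` `[ratr q.2.1, ratr q.2.2].

(** Rational boxes are countably many; asking for the closed box inside the open
    set leaves room for a test function supported there. *)
Lemma ratbox_nbhs (A : set (R * R)) x : open A -> A x ->
  exists q, ratbox q x /\ cratbox q `<=` A.
Proof.
move=> oA Ax; have /nbhs_ballP[e/= e0 eA] : nbhs x A by exact: open_nbhs_nbhs.
have itvq (t : R) : exists q : rat * rat,
    [/\ t \in `]ratr q.1, ratr q.2[, t - e < ratr q.1 & ratr q.2 < t + e].
  have /rat_in_itvoo[a] : t - e < t by rewrite ltrBlDr ltrDl.
  have /rat_in_itvoo[b] : t < t + e by rewrite ltrDl.
  rewrite !in_itv/= => /andP[b1 b2] /andP[a1 a2].
  by exists (a, b); rewrite in_itv/= a2 b1.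
have [[a b]/= [ab1 ab2 ab3]] := itvq x.1.
have [[c d]/= [cd1 cd2 cd3]] := itvq x.2.
exists ((a, b), (c, d)); split; first by split.
move=> [y1 y2] [/=]; rewrite !in_itv/= => /andP[y1a y1b] /andP[y2a y2b].
apply: eA; split => /=; rewrite /ball/= ltr_distlC; apply/andP; split; lra.
Qed.

Lemma measurable_ratbox q : measurable (ratbox q).
Proof. by apply: measurableX; exact: measurable_itv. Qed.

(** The sigma-algebra of the plane is the product one, so this is not a matter of
    definition: an open set is a countable union of rational boxes. *)
Lemma open_plane_measurable (A : set (R * R)) : open A -> measurable A.
Proof.
move=> oA; rewrite (_ : A = \bigcup_q (if `[< cratbox q `<=` A >] then ratbox q else set0)).
  apply: countable_bigcupT_measurable => [|q]; first exact: countableP.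
  by case: ifP => _ //; exact: measurable_ratbox.
apply/seteqP; split => [x Ax|x [q _]].
  by have [q [qx /asboolP qA]] := ratbox_nbhs oA Ax; exists q => //; rewrite qA.
case: asboolP => // qA [x1 x2]; apply: qA; split.
  exact: (subset_itv_oo_cc x1).
exact: (subset_itv_oo_cc x2).
Qed.

Lemma continuous_plane_measurable f : continuous f -> measurable_fun setT f.
Proof.
move=> cf; apply: (measurability _ (RGenOpens.measurableE R)) => _ [_ [a [b ->] <-]].
rewrite setTI; apply: open_plane_measurable.
by move: cf => /continuousP; apply; exact: interval_open.
Qed.

End plane_topology.

(** * Smooth functions, supports and bumps *)

Lemma is_derive_ext (R : realType) (V W : normedModType R) (f g : V -> W)
    (x v : V) (df dg : W) :
  is_derive x v f df -> f =1 g -> df = dg -> is_derive x v g dg.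
Proof. by move=> h /funext <- <-. Qed.

Section smooth.
Variable R : realType.
Implicit Types (f g phi : R * R -> R) (U : set (R * R)).

Lemma isC_continuous n f : isC n f -> continuous f.
Proof. by case: n => [|n] []. Qed.

Lemma isC_derivable n f j x : isC n.+1 f -> derivable f x (base R j).
Proof. by move=> [_ [+ _]]; exact. Qed.

Lemma isC_derive n f j : isC n.+1 f -> isC n ('D_(base R j) f).
Proof. by move=> [_ [_ +]]; exact. Qed.

Lemma isCS n f : isC n.+1 f -> isC n f.
Proof.
elim: n f => [|n IH] f fC; split => //; first exact: isC_continuous fC.
- exact: isC_continuous fC.
- by split=> [j x|j]; [exact: isC_derivable fC|exact/IH/isC_derive].
Qed.

Lemma isC_cst n (c : R) : isC n (fun=> c).
Proof.
elim: n c => [|n IH] c; split => //; try by move=> ?; exact: cst_continuous.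
split=> [j x|j]; first exact: derivable_cst.
under [fun _ => _]eq_fun do rewrite derive_cst.
exact: IH.
Qed.

Lemma isCD n f g : isC n f -> isC n g -> isC n (fun x => f x + g x).
Proof.
elim: n f g => [|n IH] f g fC gC.
  by split => // x; apply: cvgD; [exact: (isC_continuous fC)|exact: (isC_continuous gC)].
split; first by move=> x; apply: cvgD;
  [exact: (isC_continuous fC)|exact: (isC_continuous gC)].
split=> [j x|j].
  by apply: derivableD; [exact: isC_derivable fC|exact: isC_derivable gC].
rewrite (_ : (fun x => _) = fun x => 'D_(base R j) f x + 'D_(base R j) g x).
  by apply: IH; exact: isC_derive.
apply/funext => x.
by rewrite -deriveD//; [exact: isC_derivable fC|exact: isC_derivable gC].
Qed.

Lemma isCM n f g : isC n f -> isC n g -> isC n (fun x => f x * g x).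
Proof.
elim: n f g => [|n IH] f g fC gC.
  by split => // x; apply: cvgM; [exact: (isC_continuous fC)|exact: (isC_continuous gC)].
split; first by move=> x; apply: cvgM;
  [exact: (isC_continuous fC)|exact: (isC_continuous gC)].
split=> [j x|j].
  by apply: derivableM; [exact: isC_derivable fC|exact: isC_derivable gC].
rewrite (_ : (fun x => _) =
    fun x => f x * 'D_(base R j) g x + g x * 'D_(base R j) f x).
  by apply: isCD; apply: IH; (try exact: isC_derive); exact: isCS.
apply/funext => x.
by rewrite -[_ + _]deriveM//; [exact: isC_derivable fC|exact: isC_derivable gC].
Qed.

Definition supp phi : set (R * R) := closure [set x | phi x != 0].

(** Off the support the function vanishes on a neighbourhood, so its derivatives
    vanish there as well. *)
Lemma supp_derive phi j : supp ('D_(base R j) phi) `<=` supp phi.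
Proof.
rewrite /supp [X in _ `<=` X](closure_id _).1; last exact: closed_closure.
apply: closure_subset => x /= Dx; apply: contrapT => nx.
move/negP: Dx; apply; apply/eqP.
have : \forall y \near x, (fun=> 0) y = phi y.
  have oU : open (~` closure [set x | phi x != 0]).
    exact/closed_openC/closed_closure.
  have : nbhs x (~` closure [set x | phi x != 0]) by exact: open_nbhs_nbhs.
  apply: filterS => y ny; apply/esym/eqP; apply: contrapT => /negP phiy.
  by apply: ny; exact: subset_closure.
move=> /near_eq_derive <-; exact: derive_cst.
Qed.

Lemma test_fun_derive U phi j : test_fun U phi -> test_fun U ('D_(base R j) phi).
Proof.
move=> [phiC phico phiU]; split => [n||].
- exact/isC_derive/phiC.
- apply: (subclosed_compact _ phico); first exact: closed_closure.
  exact: supp_derive.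
- exact: subset_trans (@supp_derive phi j) phiU.
Qed.

Lemma test_funM U phi g : test_fun U phi -> (forall n, isC n g) ->
  test_fun U (fun x => phi x * g x).
Proof.
move=> [phiC phico phiU] gC.
have sub : closure [set x | phi x * g x != 0] `<=` closure [set x | phi x != 0].
  by apply: closure_subset => x /=; rewrite mulf_eq0 negb_or => /andP[].
split => [n||]; first exact: isCM.
- apply: (subclosed_compact _ phico) => //; exact: closed_closure.
- exact: subset_trans sub phiU.
Qed.

Lemma test_fun0 U : test_fun U (fun=> 0).
Proof.
have e : closure [set x : R * R | (0 : R) != 0] = set0.
  by rewrite (_ : [set _ | _] = set0) ?closure0//; apply/seteqP; split=> // x /=; rewrite eqxx.
by split => [n||]; rewrite ?e//; [exact: isC_cst|exact: compact0].
Qed.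

Lemma test_fun_bounded U phi : test_fun U phi ->
  exists M, 0 <= M /\ forall x, `|phi x| <= M.
Proof.
move=> [phiC phico phiU].
have cphi : continuous phi by exact: isC_continuous (phiC 0%N).
have /compact_bounded[M [Mr MB]] : compact (phi @` supp phi).
  by apply: continuous_compact => //; exact: continuous_subspaceT.
exists (`|M| + 1); split; first by rewrite addr_ge0.
move=> x; have [->|px] := eqVneq (phi x) 0; first by rewrite normr0 addr_ge0.
apply: (MB (`|M| + 1)); first by rewrite (le_lt_trans (ler_norm _))// ltrDl.
by exists x => //; exact: subset_closure.
Qed.

Lemma test_fun_out U phi x : test_fun U phi -> ~ U x -> phi x = 0.
Proof.
move=> [_ _ phiU] Ux; apply/eqP; apply: contrapT => /negP px.
by apply: Ux; apply: phiU; exact: subset_closure.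
Qed.

Lemma test_fun_measurable U phi D : test_fun U phi -> measurable_fun D phi.
Proof.
move=> [phiC _ _]; apply: measurable_funTS; apply: continuous_plane_measurable.
exact: isC_continuous (phiC 0%N).
Qed.

End smooth.

Section bump.
Variable R : realType.

(** The functions t^(-m) exp(-1/t), extended by 0; for m = 0 this is the classical
    smooth function that is flat at the origin.  The powers are included to make
    the family stable under differentiation. *)
Definition flat (m : nat) (t : R) : R :=
  if 0 < t then t^-1 ^+ m * expR (- t^-1) else 0.

(** The bound is one term of the exponential series at 1/t.  It shows that every
    function of the family is continuous at 0, hence, since the difference
    quotient of [flat m] at 0 is [flat m.+1], that its derivative at 0 is 0. *)
Lemma flat_le m (t : R) : `|flat m t| <= (m.+1)`!%:R * `|t|.
Proof.
rewrite /flat; case: ifPn => [t0|_]; last by rewrite normr0 mulr_ge0.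
have ti0 : 0 < t^-1 by rewrite invr_gt0.
rewrite ger0_norm; last by rewrite mulr_ge0 ?expR_ge0// exprn_ge0 ?ltW.
rewrite gtr0_norm// expRN ler_pdivrMr ?expR_gt0//.
have := expR_ge1Dxn m (ltW ti0).
have f0 : 0 < (m.+1)`!%:R :> R by rewrite ltr0n fact_gt0.
move=> /(le_trans (_ : t^-1 ^+ m.+1 / (m.+1)`!%:R <= _)) h.
have {}h := h (ltac:(by rewrite lerDr)).
rewrite ler_pdivrMr// in h.
rewrite -(@ler_pM2r _ t^-1)// -exprSr (le_trans h)//.
by rewrite mulrAC mulfK ?gt_eqF// mulrC.
Qed.

Lemma flat_ge0 m (t : R) : 0 <= flat m t.
Proof.
rewrite /flat; case: ifPn => // t0.
by rewrite mulr_ge0 ?expR_ge0// exprn_ge0// invr_ge0 ltW.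
Qed.

Lemma is_derive_flat m (t : R) :
  is_derive t 1 (flat m) (flat m.+2 t - m%:R * flat m.+1 t).
Proof.
have [t0|t0|->] := ltgtP t 0.
- rewrite /flat !ltNge (ltW t0)/= mulr0 subr0.
  apply: (@near_eq_is_derive _ _ _ (cst 0)).
  near=> s; rewrite ltNge; case: leP => // s0.
  have : s < 0 by near: s; exact: lt_nbhsl.
  by rewrite ltNge ltW.
- apply: (@near_eq_is_derive _ _ _ (fun s : R => s^-1 ^+ m * expR (- s^-1))).
    near=> s; rewrite /flat; case: ifPn => //; rewrite -leNgt => s0.
    have : 0 < s by near: s; exact: lt_nbhsr.
    by rewrite ltNge s0.
  have tn0 : t != 0 by rewrite gt_eqF.
  have dV := @is_deriveV _ id t 1 1 tn0 (is_derive_id _ _).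
  have dX := is_deriveX m dV.
  have dN := is_deriveN dV.
  have dE := @is_derive1_comp _ expR _ t _ _ (is_derive_expR _) dN.
  apply: (is_derive_ext (is_deriveM dX dE)) => [s|].
    by rewrite [LHS]/= mulrfctE exprfctE.
  rewrite /flat t0 /=.
  rewrite /GRing.scale/= !exprfctE/= !mulr1.
  case: m dX {dV dN dE} => [|m] _ /=.
    by rewrite -!exprVn; ring.
  rewrite -!exprVn !exprS; ring.
have e0 n : flat n 0 = 0 by rewrite /flat ltxx.
rewrite !e0 mulr0 subr0.
have lim0 : h^-1 *: ((flat m \o shift 0) (h *: (1 : R)) - flat m 0) @[h --> 0^'] --> (0 : R).
  rewrite e0 /=.
  apply: (@cvg_trans _ (flat m.+1 h @[h --> (0:R)^'])).
    apply: near_eq_cvg; near=> h.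
    rewrite subr0 addr0 /flat [h *: 1]mulr1; case: ifPn => h0; last by rewrite scaler0.
    by rewrite exprS -mulrA.
  apply/cvgr0Pnorm_le => e e0'; near=> h.
  apply: (le_trans (flat_le _ _)).
  rewrite -ler_pdivlMl ?ltr0n ?fact_gt0//.
  near: h; apply: dnbhs0_le; rewrite mulr_gt0// invr_gt0 ltr0n fact_gt0//.
split; first by apply/cvg_ex; exists 0.
exact: cvg_lim lim0.
Unshelve. all: by end_near. Qed.

(** Partial derivatives of such a function are combinations of two functions of
    the same form, hence the induction on the order, for all [m] at once. *)
Lemma isC_flat n m (a b c : R) :
  isC n (fun x : R * R => flat m (a * x.1 + b * x.2 + c)).
Proof.
pose l (x : R * R) := a * x.1 + b * x.2 + c.
pose k (j : 'I_2) := if j == ord0 then a else b.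
have dl j x : is_derive x (base R j) l (k j).
  have [t [s ->]] := ptP j x; apply: is_derive_line; rewrite /l /pt /k.
  case: ifP => _ /=.
    apply: (is_derive_ext (is_deriveD (is_deriveZ a (is_derive_id t 1))
      (is_derive_cst (b * s + c) t 1))) => [u|].
      by rewrite !fctE addrA.
    by rewrite addr0 [_ *: _]mulr1.
  apply: (is_derive_ext (is_deriveD (is_deriveZ b (is_derive_id t 1))
    (is_derive_cst (a * s + c) t 1))) => [u|].
    by rewrite !fctE addrA [_ + a * s]addrC.
  by rewrite addr0 [_ *: _]mulr1.
have cl : continuous l.
  move=> x; apply: cvgD; last exact: cvg_cst.
  apply: cvgD; apply: cvgM; try exact: cvg_cst; [exact: cvg_fst|exact: cvg_snd].
have cf p : continuous (fun x => flat p (l x)).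
  move=> x; apply: (@continuous_comp _ _ _ l (flat p)); first exact: cl.
  apply: differentiable_continuous; apply/derivable1_diffP.
  by have [] := is_derive_flat p (l x).
have df p j x : is_derive x (base R j) (fun x => flat p (l x))
    (k j * (flat p.+2 (l x) + (- p%:R) * flat p.+1 (l x))).
  have [t [s xE]] := ptP j x; rewrite xE; apply: is_derive_line.
  have dl1 : is_derive t 1 (fun t => l (pt j t s)) (k j).
    by have [h1 h2] := dl j (pt j t s); split; rewrite -?derivable_line -?derive_line.
  apply: (is_derive_ext (@is_derive1_comp _ (flat p) _ t _ _ (is_derive_flat p _) dl1)) => //.
  by rewrite mulrC mulNr.
rewrite -/l; elim: n m => [|n IH] m; split => //; try exact: cf.
split => [j x|j]; first by have [] := df m j x.
rewrite (_ : (fun x => _) = fun x =>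
    k j * (flat m.+2 (l x) + (- m%:R) * flat m.+1 (l x))).
  apply: isCM; first exact: isC_cst.
  by apply: isCD => //; apply: isCM => //; exact: isC_cst.
by apply/funext => x; have [] := df m j x.
Qed.

(** The product of the flat functions of the distances to the four sides of the
    box, scaled by N + 1.  The arguments are written as full affine forms, with
    zero coefficients, to be instances of [isC_flat]. *)
Definition boxbump (a b c d : R) (N : nat) (x : R * R) : R :=
  flat 0 (N.+1%:R * x.1 + 0 * x.2 + - (N.+1%:R * a)) *
  (flat 0 (- N.+1%:R * x.1 + 0 * x.2 + N.+1%:R * b) *
  (flat 0 (0 * x.1 + N.+1%:R * x.2 + - (N.+1%:R * c)) *
   flat 0 (0 * x.1 + - N.+1%:R * x.2 + N.+1%:R * d))).

Lemma flat0_le1 (t : R) : flat 0 t <= 1.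
Proof.
rewrite /flat; case: ifPn => // t0.
by rewrite expr0 mul1r -expR0 ler_expR oppr_le0 invr_ge0 ltW.
Qed.

Lemma boxbump_ge0 a b c d N x : 0 <= boxbump a b c d N x.
Proof. by rewrite /boxbump !mulr_ge0// flat_ge0. Qed.

Lemma boxbump_le1 a b c d N x : boxbump a b c d N x <= 1.
Proof. by rewrite /boxbump !mulr_ile1// ?mulr_ge0 ?flat_ge0 ?flat0_le1. Qed.

Lemma boxbumpE a b c d N (x : R * R) : boxbump a b c d N x =
  flat 0 (N.+1%:R * (x.1 - a)) * (flat 0 (N.+1%:R * (b - x.1)) *
  (flat 0 (N.+1%:R * (x.2 - c)) * flat 0 (N.+1%:R * (d - x.2)))).
Proof.
by rewrite /boxbump; congr (flat 0 _ * (flat 0 _ * (flat 0 _ * flat 0 _))); ring.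
Qed.

Lemma flat0_gt0 (t : R) : (flat 0 t != 0) = (0 < t).
Proof.
rewrite /flat; case: ifPn => [t0|_]; last by rewrite eqxx.
by rewrite expr0 mul1r gt_eqF// expR_gt0.
Qed.

Lemma boxbump_neq0 a b c d N (x : R * R) :
  (boxbump a b c d N x != 0) = (x.1 \in `]a, b[) && (x.2 \in `]c, d[).
Proof.
rewrite boxbumpE !mulf_eq0 !negb_or !flat0_gt0 !pmulr_rgt0 ?ltr0n// !subr_gt0.
by rewrite !in_itv/= !andbA.
Qed.

Lemma boxbump_test U (a b c d : R) N : `[a, b] `*` `[c, d] `<=` U ->
  test_fun U (boxbump a b c d N).
Proof.
move=> sub.
have co : compact (`[a, b] `*` `[c, d]) by apply: compact_setX; exact: segment_compact.
have scl : closure [set x | boxbump a b c d N x != 0] `<=` `[a, b] `*` `[c, d].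
  have /closure_id -> : closed (`[a, b] `*` `[c, d]).
    apply: compact_closed co; exact: norm_hausdorff.
  apply: closure_subset => x /=; rewrite boxbump_neq0 => /andP[x1 x2].
  by split; [exact: (subset_itv_oo_cc x1)|exact: (subset_itv_oo_cc x2)].
split; last exact: subset_trans scl sub.
- move=> n; do !apply: isCM; exact: isC_flat.
- apply: (subclosed_compact _ co) => //; exact: closed_closure.
Qed.

Lemma flat0_cvg (t : R) : flat 0 (N.+1%:R * t) @[N --> \oo] --> ((0 < t)%R%:R : R).
Proof.
have [t0|t0] := ltP 0 t; last first.
  rewrite (_ : (fun N => _) = cst 0); first exact: cvg_cst.
  by apply/funext => N; rewrite /flat pmulr_rgt0 ?ltr0n// ltNge t0.
rewrite (_ : (fun N => _) = expR \o (fun N => - (harmonic N / t))).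
  suff : (expR \o (fun N => - (harmonic N / t))) @ \oo --> expR 0 by rewrite expR0.
  apply: cvg_comp; last exact: continuous_expR.
  rewrite -oppr0 -(mul0r (t^-1)); apply: cvgN; apply: cvgM; last exact: cvg_cst.
  exact: cvg_harmonic.
apply/funext => N; rewrite /flat pmulr_rgt0 ?ltr0n// t0 expr0 mul1r /=.
by rewrite invfM.
Qed.

(** On the box every factor is exp(-1/(N t)) with t > 0, which tends to 1. *)
Lemma boxbump_cvg a b c d x :
  boxbump a b c d N x @[N --> \oo] --> (\1_(`]a, b[ `*` `]c, d[) x : R).
Proof.
rewrite (_ : \1_ _ _ = ((0 < x.1 - a)%R%:R) * (((0 < b - x.1)%R%:R) *
    ((0 < x.2 - c)%R%:R * (0 < d - x.2)%R%:R)) :> R).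
  under eq_fun do rewrite boxbumpE.
  by do !apply: cvgM; exact: flat0_cvg.
rewrite indicE -!natrM !mulnb !subr_gt0 !andbA; congr (_%:R); congr nat_of_bool.
by rewrite in_setX !mem_setE !in_itv/= -!andbA.
Qed.

End bump.

(** * The fundamental lemma of the calculus of variations *)

Lemma negligible_bigcup_count d (T : sigmaRingType d) (R : realFieldType)
    (mu : {measure set T -> \bar R}) (I : countType) (F : I -> set T) :
  (forall i, mu.-negligible (F i)) -> mu.-negligible (\bigcup_i F i).
Proof.
move=> F0; pose N n := if @unpickle I n is Some i then F i else set0.
have : mu.-negligible (\bigcup_n N n).
  apply: negligible_bigcup => n; rewrite /N; case: unpickle => [i|] //.
  exact: negligible_set0.
by apply: negligibleS => x [i _ Fx]; exists (pickle i) => //; rewrite /N pickleK.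
Qed.

Section fundamental_lemma.
Variable R : realType.
Notation mu := (plane_measure R).

Definition box (a b c d : R) : set (R * R) := `]a, b[ `*` `]c, d[.

Definition boxes : set (set (R * R)) :=
  [set A | exists a b c d, A = box a b c d].

Lemma measurable_box a b c d : measurable (box a b c d).
Proof. by apply: measurableX; exact: measurable_itv. Qed.

Lemma boxI a b c d a' b' c' d' : box a b c d `&` box a' b' c' d' =
  box (Num.max a a') (Num.min b b') (Num.max c c') (Num.min d d').
Proof.
apply/seteqP; split => [[x y] [[/= + +] [/= + +]]|[x y] [/=]].
  rewrite !in_itv/= => /andP[h1 h2] /andP[h3 h4] /andP[h5 h6] /andP[h7 h8].
  by split; rewrite /= in_itv/= gt_max lt_min; apply/andP; split; apply/andP.
rewrite !in_itv/= !gt_max !lt_min => /andP[/andP[h1 h2] /andP[h3 h4]].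
move=> /andP[/andP[h5 h6] /andP[h7 h8]].
by split; split; rewrite /= in_itv/=; apply/andP.
Qed.

Lemma setI_closed_boxes : setI_closed boxes.
Proof.
move=> _ _ [a [b [c [d ->]]]] [a' [b' [c' [d' ->]]]].
by rewrite boxI; do 4 eexists.
Qed.

(** The preimages of Borel sets under a projection are generated by strips, and a
    strip is a countable union of bounded boxes. *)
Lemma measurable_boxesE : @measurable _ (R * R)%type = <<s boxes >>.
Proof.
apply/seteqP; split; last first.
  apply: smallest_sub; first exact: sigma_algebra_measurable.
  by move=> _ [a [b [c [d ->]]]]; exact: measurable_box.
have sB : sigma_algebra setT <<s boxes >> by exact: smallest_sigma_algebra.
have half (p : R * R -> R) (S : nat -> R -> R -> set (R * R)) :
    (forall n a b, boxes (S n a b)) ->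
    (forall a b, p @^-1` `]a, b[ = \bigcup_n S n a b) ->
    forall A : set R, measurable A -> <<s boxes >> (p @^-1` A).
  move=> SB SE A mA0; have [s0 sC sU] := sB.
  have mA : (@RGenOpens.G R).-sigma.-measurable A.
    by rewrite -RGenOpens.measurableE.
  apply: (mA [set A | <<s boxes >> (p @^-1` A)]); split.
    split => [|B /= hB|F hF] /=.
    - by rewrite preimage_set0.
    - by rewrite setTD preimage_setC -setTD; exact: sC.
    - by rewrite preimage_bigcup; exact: sU.
  move=> _ [a [b ->]] /=; rewrite SE; apply: sU => n.
  exact: sub_sigma_algebra.
have cov (t : R) : exists n : nat, t \in `]- n%:R, n%:R[.
  have [n /andP[n1 n2]] : exists n : nat, (`|t| < n%:R)%R && true.
    exists (Num.truncn `|t|).+1; rewrite andbT.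
    by have /andP[] := truncn_itv (normr_ge0 t).
  by exists n; rewrite in_itv/= -ltr_norml.
have h1 := half fst (fun n a b => box a b (- n%:R) n%:R).
have h2 := half snd (fun n a b => box (- n%:R) n%:R a b).
rewrite measurable_prod_measurableType.
apply: smallest_sub => // _ [A mA] [B mB] <-.
rewrite (_ : A `*` B = (fst @^-1` A) `&` (snd @^-1` B))//.
have sI : setI_closed <<s boxes >>.
  have [s0 sC sU] := sB.
  by move=> X Y sX sY; exact: (@measurableI _ (g_sigma_algebraType boxes)).
apply: sI.
- apply: h1 => // [n a b|a b]; first by do 4 eexists.
  apply/seteqP; split => [[x y] /= xab|[x y] [n _ [/=]]//].
  by have [n ny] := cov y; exists n.
- apply: h2 => // [n a b|a b]; first by do 4 eexists.
  apply/seteqP; split => [[x y] /= yab|[x y] [n _ [/=]]//].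
  by have [n nx] := cov x; exists n.
Qed.

Variables (U : set (R * R)) (g : R * R -> R).
Hypothesis oU : open U.
Hypothesis ig : mu.-integrable U (EFin \o g).
Hypothesis g0 : forall phi, test_fun U phi ->
  (\int[mu]_(x in U) (g x * phi x)%:E = 0)%E.

Let mU : measurable U. Proof. exact: open_plane_measurable. Qed.

Let mg : measurable_fun U g.
Proof. by apply/measurable_EFinP; exact: measurable_int ig. Qed.

(** The bumps of a box are test functions bounded by 1 that converge to the
    indicator of the box: dominated convergence. *)
Lemma integral_box0 a b c d : `[a, b] `*` `[c, d] `<=` U ->
  (\int[mu]_(x in box a b c d) (g x)%:E = 0)%E.
Proof.
move=> sub.
have boxU : box a b c d `<=` U.
  apply: subset_trans sub => -[x y] [/= h1 h2].
  by split; [exact: (subset_itv_oo_cc h1)|exact: (subset_itv_oo_cc h2)].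
pose f_ N x : \bar R := (g x * boxbump a b c d N x)%:E.
pose f x : \bar R := (g x * \1_(box a b c d) x)%:E.
have [//|//|//|||_ _] := @dominated_convergence _ _ _ mu U mU f_ f (fun x => `|g x|%:E).
- move=> N; apply/measurable_EFinP; apply: measurable_funM => //.
  exact: test_fun_measurable (boxbump_test N sub).
- apply/measurable_EFinP; apply: measurable_funM => //.
  by apply: measurable_indic; exact: measurable_box.
- apply: aeW => x Ux; apply: cvg_EFin; first by apply: nearW.
  by apply: cvgM; [exact: cvg_cst|exact: boxbump_cvg].
- exact: (integrable_abse ig).
- apply: aeW => x N Ux; rewrite /f_ /= lee_fin normrM ler_piMr//.
  by rewrite ger0_norm ?boxbump_ge0 ?boxbump_le1.
rewrite (_ : [sequence _]_n = cst 0%E); last first.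
  by apply/funext => N; rewrite /f_/= g0//; exact: boxbump_test.
move=> h; have <- : (\int[mu]_(x in U) f x = 0)%E.
  exact: (cvg_unique (@ereal_hausdorff R) h (@cvg_cst _ 0%E _ \oo _)).
rewrite -[in LHS](setIidr boxU) integral_mkcondr; apply: eq_integral => x _.
by rewrite /f patchE indicE; case: ifPn => xb; rewrite ?mulr1 ?mulr0.
Qed.

(** The sets S for which [g] has integral 0 on the part of the box inside S form a
    Dynkin class.  It contains all boxes, because two boxes meet in a box, and
    boxes generate the measurable sets. *)
Lemma ae_eq0_box a b c d : `[a, b] `*` `[c, d] `<=` U ->
  ae_eq mu (box a b c d) (EFin \o g) (cst 0%E).
Proof.
move=> sub; set Q := box a b c d.
have QU : Q `<=` U.
  apply: subset_trans sub => -[x y] [/= h1 h2].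
  by split; [exact: (subset_itv_oo_cc h1)|exact: (subset_itv_oo_cc h2)].
have mQ : measurable Q by exact: measurable_box.
have iE E : E `<=` Q -> measurable E -> mu.-integrable E (EFin \o g).
  move=> EQ mE. exact: (@integrableS _ _ _ mu U E _ mU mE (subset_trans EQ QU) ig).
apply: integral_ae_eq => //; first exact: iE.
suff H S : <<s boxes >> S -> (\int[mu]_(x in Q `&` S) (g x)%:E = 0)%E.
  move=> E EQ mE; rewrite -{1}(setIidr EQ) /= H ?integral0//.
  by rewrite -measurable_boxesE.
apply: (dynkin_induction (P := fun S => \int[mu]_(x in Q `&` S) (g x)%:E = 0)%E).
- exact: measurable_boxesE.
- exact: setI_closed_boxes.
- by rewrite setIT integral_box0.
- move=> _ [a' [b' [c' [d' ->]]]]; rewrite boxI; apply: integral_box0.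
  apply: subset_trans sub => -[x y] [/= + +].
  rewrite !in_itv/=.
  rewrite !ge_max !le_min => /andP[/andP[h1 h2] /andP[h3 h4]].
  move=> /andP[/andP[h5 h6] /andP[h7 h8]].
  by split; apply/andP.
- move=> E mE QE0.
  have := integral_box0 sub.
  rewrite -/Q -{1}(setUIDK Q E) integral_setU//; last 4 first.
  + exact: measurableI.
  + exact: measurableD.
  + rewrite setUIDK; apply: measurable_funS (measurable_int _ ig) => //.
  + apply/disj_setPS => x [[_ Ex] [_]]//.
  by rewrite QE0 add0e setDE.
- move=> F mF tF QF; rewrite setI_bigcupr integral_bigcup//.
  + by rewrite eseries0// => n _ _; exact: QF.
  + by move=> i j _ _ [x [[_ Fi] [_ Fj]]]; apply: tF => //; exists x.
  + by move=> n; exact: (measurableI _ _ mQ (mF n)).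
  + apply: iE; first by move=> x [n _ []].
    by apply: bigcupT_measurable => n; exact: (measurableI _ _ mQ (mF n)).
Qed.

(** The fundamental lemma of the calculus of variations; the open set is covered
    by countably many boxes whose closures it contains. *)
Lemma ae_eq0_of_tests : {ae mu, forall x, U x -> g x = 0}.
Proof.
pose N q := [set x | cratbox q `<=` U /\ ratbox q x /\ g x <> 0].
have : mu.-negligible (\bigcup_q N q).
  apply: negligible_bigcup_count => q.
  have [qU|qU] := pselect (cratbox q `<=` U); last first.
    by apply: negligibleS (negligible_set0 _) => x [].
  have := ae_eq0_box qU; apply: negligibleS => x [_ [qx gx]] /= /(_ qx).
  by case.
apply: negligibleS => x /= /not_implyP[Ux gx].
have [q [qx qU]] := ratbox_nbhs oU Ux.
by exists q => //; split.
Qed.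

End fundamental_lemma.

(** * The disk and its square-integrable functions *)

Section disk_L2.
Variable R : realType.
Notation mu := (plane_measure R).
Implicit Types (f g : R * R -> R) (U : set (R * R)) (x : R * R).

Lemma radius_ge0 x : 0 <= radius x.
Proof. exact: sqrtr_ge0. Qed.

Lemma radius_sqr x : radius x ^+ 2 = x.1 ^+ 2 + x.2 ^+ 2.
Proof. by rewrite radiusE sqr_sqrtr// addr_ge0// sqr_ge0. Qed.

Lemma ler_fst_radius x : `|x.1| <= radius x.
Proof.
rewrite -(@ler_pXn2r _ 2)// ?nnegrE ?radius_ge0// radius_sqr real_normK ?num_real//.
by rewrite lerDl sqr_ge0.
Qed.

Lemma ler_snd_radius x : `|x.2| <= radius x.
Proof.
rewrite -(@ler_pXn2r _ 2)// ?nnegrE ?radius_ge0// radius_sqr real_normK ?num_real//.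
by rewrite lerDr sqr_ge0.
Qed.

Lemma continuous_radius : continuous (@radius R).
Proof.
move=> x; rewrite (_ : @radius R = Num.sqrt \o (fun x => x.1 ^+ 2 + x.2 ^+ 2)); last first.
  by apply/funext => y; rewrite radiusE.
apply: continuous_comp; last exact: sqrt_continuous.
apply: cvgD; rewrite expr2; apply: cvgM; (exact: cvg_fst || exact: cvg_snd).
Qed.

Lemma open_disk (r : R) : open (disk r).
Proof.
rewrite (_ : disk r = @radius R @^-1` [set t | t < r])//.
by apply: open_comp; [move=> x _; exact: continuous_radius|exact: open_lt].
Qed.

Lemma measurable_disk (r : R) : measurable (disk r).
Proof. exact: (open_plane_measurable (@open_disk r)). Qed.

(** From the open square of side 2r that contains the disk. *)
Lemma measure_disk_le (r : R) : 0 <= r -> (mu (disk r) <= ((2 * r) ^+ 2)%:E)%E.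
Proof.
move=> r0; have mi : measurable (`]- r, r[%classic : set R) by exact: measurable_itv.
have e : lebesgue_measure (`]- r, r[%classic : set R) = (2 * r)%:E.
  rewrite lebesgue_measure_itv/= lte_fin; case: ltP => h.
    by rewrite -EFinD; congr (_%:E); ring.
  have -> : r = 0 by lra.
  by rewrite mulr0.
rewrite expr2 EFinM -e -product_measure1E//.
apply: le_measure; rewrite ?inE//; first exact: measurable_disk.
  exact: measurableX.
by move=> x /= xr; split; rewrite /= in_itv/= -ltr_norml;
  [apply: le_lt_trans xr; exact: ler_fst_radius|apply: le_lt_trans xr; exact: ler_snd_radius].
Qed.

Lemma measure_disk_fin (r : R) : 0 <= r -> (mu (disk r) < +oo)%E.
Proof. by move=> r0; rewrite (le_lt_trans (measure_disk_le r0)) ?ltry. Qed.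

Section L2.
Variables (U : set (R * R)).
Hypothesis mU : measurable U.

(** From |f g| <= f^2 + g^2. *)
Lemma inL2M f g : inL2 U f -> inL2 U g ->
  mu.-integrable U (fun x => (f x * g x)%:E).
Proof.
move=> [mf if2] [mg ig2].
apply: (@le_integrable _ _ _ mu U mU _ (fun x => (f x ^+ 2)%:E + (g x ^+ 2)%:E)%E).
- by apply/measurable_EFinP; exact: measurable_funM.
- move=> x Ux; rewrite -EFinD !abse_EFin lee_fin normrM.
  rewrite [leRHS]ger0_norm ?addr_ge0 ?sqr_ge0//.
  rewrite -(real_normK (num_real (f x))) -(real_normK (num_real (g x))).
  have := sqr_ge0 (`|f x| - `|g x|); have := normr_ge0 (f x); have := normr_ge0 (g x).
  nra.
- exact: (@integrableD _ _ _ mu U mU).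
Qed.

Lemma inL2D f g : inL2 U f -> inL2 U g -> inL2 U (fun x => f x + g x).
Proof.
move=> fL gL; have fg := inL2M fL gL; have [mf if2] := fL; have [mg ig2] := gL.
split; first exact: measurable_funD.
rewrite (_ : (fun x => _) = (fun x => ((f x ^+ 2)%:E + (2%:E * (f x * g x)%:E)) + (g x ^+ 2)%:E)%E).
  apply: (@integrableD _ _ _ mu U mU) => //; apply: (@integrableD _ _ _ mu U mU) => //.
  exact: (@integrableZl _ _ _ mu U mU).
by apply/funext => x; rewrite -EFinM -!EFinD; congr (_%:E); ring.
Qed.

Lemma inL2Z (c : R) f : inL2 U f -> inL2 U (fun x => c * f x).
Proof.
move=> [mf if2]; split; first exact: measurable_funM.
rewrite (_ : (fun x => _) = (fun x => (c ^+ 2)%:E * (f x ^+ 2)%:E)%E).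
  exact: (@integrableZl _ _ _ mu U mU).
by apply/funext => x; rewrite -EFinM exprMn.
Qed.

Lemma inL2B f g : inL2 U f -> inL2 U g -> inL2 U (fun x => f x - g x).
Proof.
move=> fL gL; under eq_fun do rewrite -mulN1r.
by apply: inL2D => //; exact: inL2Z.
Qed.

Hypothesis finU : (mu U < +oo)%E.

Lemma bounded_integrable f (M : R) : measurable_fun U f ->
  (forall x, U x -> `|f x| <= M) -> mu.-integrable U (fun x => (f x)%:E).
Proof.
move=> mf fM; apply: (@le_integrable _ _ _ mu U mU _ (cst M%:E)).
- exact/measurable_EFinP.
- by move=> x Ux /=; rewrite lee_fin (le_trans (fM _ Ux) (ler_norm _)).
- apply/(@integrableP _ _ _ mu U); split; first exact: measurable_cst.
  by rewrite /= (@integral_cst _ _ _ mu U mU) lte_mul_pinfty.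
Qed.

Lemma inL2_bounded f (M : R) : measurable_fun U f ->
  (forall x, U x -> `|f x| <= M) -> inL2 U f.
Proof.
move=> mf fM; split => //; apply: (@bounded_integrable _ (M ^+ 2)).
  exact: measurable_funX.
move=> x Ux; rewrite normrX lerXn2r ?nnegrE ?fM//.
exact: le_trans (fM _ Ux).
Qed.

Lemma inL2_test phi : test_fun U phi -> inL2 U phi.
Proof.
move=> tp; have [M [_ pM]] := test_fun_bounded tp.
by apply: (@inL2_bounded _ M) => //; exact: test_fun_measurable tp.
Qed.

Lemma inL2_1 f : inL2 U f -> mu.-integrable U (fun x => (f x)%:E).
Proof.
move=> fL; have cL : inL2 U (cst 1) by apply: (@inL2_bounded _ 1) => // x _; rewrite normr1.
by have := inL2M fL cL; under eq_fun do rewrite /= mulr1.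
Qed.

End L2.
End disk_L2.

(** * Integration by parts along lines *)

Section line_integration_by_parts.
Variable R : realType.
Notation mu := (plane_measure R).
Notation leb := (@lebesgue_measure R).
Implicit Types (j : 'I_2) (r : R).

(** Fubini's theorem.  The line [s = 0] may be left out because a point is a null
    set of the transversal. *)
Lemma integral_plane_lines0 j (F : R * R -> R) :
  mu.-integrable setT (EFin \o F) ->
  (forall s : R, s != 0 -> (\int[leb]_t (F (pt j t s))%:E = 0)%E) ->
  (\int[mu]_x (F x)%:E = 0)%E.
Proof.
move=> iF F0.
have null0 (G : R -> \bar R) : measurable_fun setT G ->
    (forall s : R, s != 0 -> G s = 0%E) -> (\int[leb]_s G s = 0)%E.
  move=> mG G0; rewrite -(@integral_setD1 _ _ 0 setT).
  - by apply: integral0_eq => s [_ /eqP]; exact: G0.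
  - by apply: measurableD => //; exact: measurable_set1.
  - exact: measurable_funTS.
move: F0; rewrite /pt; case: (j == ord0) => F0.
- rewrite -(integral21_prod_meas1 iF); apply: null0; last exact: F0.
  exact: (measurable_fubini_G iF).
- rewrite -(integral12_prod_meas1 iF); apply: null0; last exact: F0.
  exact: (measurable_fubini_F iF).
Qed.

Lemma ler_pt_radius j (t s : R) : `|t| <= radius (pt j t s).
Proof.
rewrite /pt; case: ifP => _; [exact: (ler_fst_radius (t, s))|exact: (ler_snd_radius (s, t))].
Qed.

(** The integrand is the derivative of the product of [v] and [phi] along the line,
    and [phi] vanishes where the line has left the disk. *)
Lemma integral_derive_test r j (v g phi : R * R -> R) (s : R) : 0 < r ->
  test_fun (disk r) phi ->
  (forall t : R, is_derive t 1 (fun t => v (pt j t s)) (g (pt j t s))) ->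
  continuous (fun t => g (pt j t s)) ->
  (\int[leb]_t (v (pt j t s) * 'D_(base R j) phi (pt j t s) +
                g (pt j t s) * phi (pt j t s))%:E = 0)%E.
Proof.
move=> r0 tphi dv cg.
have out p (t : R) : test_fun (disk r) p -> r <= `|t| -> p (pt j t s) = 0.
  move=> tp rt; apply: (test_fun_out tp); rewrite /disk /= => h.
  by have := lt_le_trans h (le_trans rt (ler_pt_radius j t s)); rewrite ltxx.
have tdphi := test_fun_derive j tphi.
have [phiC _ _] := tphi.
pose h t := v (pt j t s) * 'D_(base R j) phi (pt j t s) + g (pt j t s) * phi (pt j t s).
pose H t := v (pt j t s) * phi (pt j t s).
have dphi (t : R) : is_derive t 1 (fun t => phi (pt j t s)) ('D_(base R j) phi (pt j t s)).
  by split; [rewrite -derivable_line; exact: isC_derivable (phiC 1%N)|rewrite -derive_line].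
have dH (t : R) : is_derive t 1 H (h t).
  apply: (is_derive_ext (is_deriveM (dv t) (dphi t))) => //.
  by rewrite /h /GRing.scale/= [phi _ * _]mulrC.
have cd (w : R -> R) (dw : R -> R) : (forall t : R, is_derive t 1 w (dw t)) -> continuous w.
  move=> dw' t; apply: differentiable_continuous; apply/derivable1_diffP.
  by have [] := dw' t.
have cpt : continuous (fun t => pt j t s) by exact: continuous_pt.
have ch : continuous h.
  move=> t; apply: cvgD; apply: cvgM.
  - exact: (cd _ _ dv).
  - apply: (@continuous_comp _ _ _ (fun t => pt j t s) ('D_(base R j) phi)); first exact: cpt.
    by apply: (isC_continuous (n := 0)); apply: isC_derive; exact: phiC.
  - exact: cg.
  - exact: (cd _ _ dphi).
transitivity (\int[leb]_(t in `[(- r)%R, r]) (h t)%:E)%E.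
  rewrite [in RHS]integral_mkcond; apply: eq_integral => t _.
  rewrite patchE; case: ifPn => //; rewrite notin_setE /= in_itv/= -ler_norml => /negP.
  rewrite -ltNge => /ltW rt; rewrite /h (out phi)// (out ('D_(base R j) phi))//.
  by rewrite !mulr0 addr0.
have -> : (\int[leb]_(t in `[(- r)%R, r]) (h t)%:E = (H r)%:E - (H (- r))%:E)%E.
  apply: continuous_FTC2.
  - lra.
  - exact: continuous_subspaceT.
  - split.
    + by move=> t _; have [] := dH t.
    + by apply: cvg_at_right_filter; exact: (cd _ _ dH).
    + by apply: cvg_at_left_filter; exact: (cd _ _ dH).
  - by move=> t _; rewrite derive1E; have [] := dH t.
have o1 : phi (pt j r s) = 0 by apply: out => //; exact: ler_norm.
have o2 : phi (pt j (- r) s) = 0 by apply: out => //; rewrite normrN; exact: ler_norm.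
by rewrite /H o1 o2 !mulr0 sube0.
Qed.

(** The axis [s = 0] is excluded because [ubar], to which this is applied, is
    singular at the origin; the other lines are almost all lines. *)
Lemma weak_partial_lines r j (v g : R * R -> R) (M : R) : 0 < r ->
  measurable_fun (disk r) v -> measurable_fun (disk r) g ->
  (forall x, disk r x -> `|v x| <= M) -> (forall x, disk r x -> `|g x| <= M) ->
  (forall s : R, s != 0 -> forall t : R, is_derive t 1 (fun t => v (pt j t s)) (g (pt j t s))) ->
  (forall s : R, s != 0 -> continuous (fun t => g (pt j t s))) ->
  weak_partial (disk r) j v g.
Proof.
move=> r0 mv mg vM gM dv cg phi tphi.
have mU := @measurable_disk R r.
have finU := measure_disk_fin (ltW r0).
have tdphi := test_fun_derive j tphi.
have i1 := inL2M mU (inL2_bounded mU finU mv vM) (inL2_test mU finU tdphi).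
have i2 := inL2M mU (inL2_bounded mU finU mg gM) (inL2_test mU finU tphi).
pose F x := v x * 'D_(base R j) phi x + g x * phi x.
have FE : F = F \_ (disk r).
  apply/funext => x; rewrite patchE; case: ifPn => //; rewrite notin_setE => xU.
  by rewrite /F (test_fun_out tphi xU) (test_fun_out tdphi xU) !mulr0 addr0.
have iF : mu.-integrable (disk r) (fun x => (F x)%:E).
  rewrite (_ : (fun x => _) = (fun x => ((v x * 'D_(base R j) phi x)%:E + (g x * phi x)%:E)%E)).
    exact: (@integrableD _ _ _ mu _ mU).
  by apply/funext => x; rewrite -EFinD.
have F0 : (\int[mu]_(x in disk r) (F x)%:E = 0)%E.
  have E1 : (fun x => (F x)%:E) \_ (disk r) = (fun x => (F x)%:E).
    by apply/funext => x; rewrite patchE; case: ifPn => // xU; rewrite FE patchE (negbTE xU).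
  rewrite integral_mkcond E1; apply: (@integral_plane_lines0 j).
    by have := iF; rewrite (@integrable_mkcond _ _ _ mu _ _ mU) E1.
  move=> s s0; exact: (integral_derive_test r0 tphi (dv s s0) (cg s s0)).
move: F0; rewrite /F; under eq_integral do rewrite EFinD.
rewrite (@integralD _ _ _ mu _ mU _ _ i1 i2).
have f1 := @integrable_fin_num _ _ _ mu _ mU _ i1.
have f2 := @integrable_fin_num _ _ _ mu _ mU _ i2.
rewrite -(fineK f1) -(fineK f2) -EFinD => -[] /eqP.
by rewrite addr_eq0 => /eqP ->; rewrite EFinN.
Qed.

End line_integration_by_parts.

(** * The map ubar and its weak gradient *)

Section polar_frame.
Variable R : realType.
Implicit Types (x : R * R) (j : 'I_2) (k : nat).

Definition ca x : R := x.1 / radius x.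
Definition sa x : R := x.2 / radius x.

(** The pair (cos (k theta), sin (k theta)), built from x / R by the addition
    formulas.  In this form it is visibly differentiable away from the origin,
    while the angle itself jumps across the negative half axis. *)
Fixpoint cska k x : R * R :=
  if k is k'.+1 then
    (ca x * (cska k' x).1 - sa x * (cska k' x).2,
     sa x * (cska k' x).1 + ca x * (cska k' x).2)
  else (1, 0).

Lemma radius_eq0 x : (radius x == 0) = (x == 0).
Proof.
have := radius_sqr x; case: x => a b /= h; rewrite -sqrf_eq0 h.
by rewrite paddr_eq0 ?sqr_ge0// !sqrf_eq0.
Qed.

Lemma radius_gt0 x : x != 0 -> 0 < radius x.
Proof. by move=> x0; rewrite lt_neqAle radius_ge0 eq_sym radius_eq0 x0. Qed.

Lemma caE x : x != 0 -> cos (angle x) = ca x.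
Proof.
move=> x0; have r0 := radius_gt0 x0.
have /colP/(_ ord0) := polarE x; rewrite !mxE /= /ca => ->.
by rewrite mulrAC divff ?gt_eqF// mul1r.
Qed.

Lemma saE x : x != 0 -> sin (angle x) = sa x.
Proof.
move=> x0; have r0 := radius_gt0 x0.
have /colP/(_ ord_max) := polarE x; rewrite !mxE /= /sa => ->.
by rewrite mulrAC divff ?gt_eqF// mul1r.
Qed.

Lemma cskaE k x : x != 0 ->
  cska k x = (cos (k%:R * angle x), sin (k%:R * angle x)).
Proof.
move=> x0; elim: k => [|k IH]; first by rewrite mul0r cos0 sin0.
rewrite /= IH /= -(caE x0) -(saE x0) -nat1r mulrDl mul1r cosD sinD.
by congr (_, _).
Qed.

Lemma casa_sqr x : x != 0 -> ca x ^+ 2 + sa x ^+ 2 = 1.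
Proof.
move=> x0; have r0 := radius_gt0 x0.
rewrite /ca /sa !expr_div_n -mulrDl -radius_sqr divff// sqrf_eq0 gt_eqF//.
Qed.

Lemma cska_sqr k x : x != 0 -> (cska k x).1 ^+ 2 + (cska k x).2 ^+ 2 = 1.
Proof. by move=> x0; rewrite cskaE//= cos2Dsin2. Qed.

Lemma sqrD_le1 (a b : R) : a ^+ 2 + b ^+ 2 <= 1 -> `|a| <= 1 /\ `|b| <= 1.
Proof.
move=> h; have := sqr_ge0 a; have := sqr_ge0 b => b0 a0.
by split; rewrite -(@ler_pXn2r _ 2)// ?nnegrE// expr1n real_normK ?num_real//; lra.
Qed.

Lemma casa_le1 x : `|ca x| <= 1 /\ `|sa x| <= 1.
Proof.
have [->|x0] := eqVneq x 0; last by apply: sqrD_le1; rewrite casa_sqr.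
by rewrite /ca /sa /= !mul0r normr0.
Qed.

Lemma cska_le1 k x : `|(cska k x).1| <= 1 /\ `|(cska k x).2| <= 1.
Proof.
have [->|x0] := eqVneq x 0; last by apply: sqrD_le1; rewrite cska_sqr.
case: k => [|k] /=; first by rewrite normr0 normr1.
by rewrite /ca /sa /= !mul0r addr0 subr0 normr0.
Qed.

Lemma measurable_radius : measurable_fun setT (@Defs.radius R).
Proof. exact: (continuous_plane_measurable (@continuous_radius R)). Qed.

Lemma measurable_radiusV : measurable_fun setT (fun x : R * R => (radius x)^-1).
Proof.
(* both the inverse and the real power send 0 to 0 *)
rewrite (_ : (fun x => _) = (fun t : R => t `^ (-1)) \o (@Defs.radius R)); last first.
  by apply/funext => x /=; rewrite powR_inv1// radius_ge0.
by apply: measurableT_comp; [exact: measurable_powR|exact: measurable_radius].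
Qed.

Lemma measurable_ca : measurable_fun setT ca.
Proof. by apply: measurable_funM; [exact: measurable_fst|exact: measurable_radiusV]. Qed.

Lemma measurable_sa : measurable_fun setT sa.
Proof. by apply: measurable_funM; [exact: measurable_snd|exact: measurable_radiusV]. Qed.

Lemma measurable_cska k : measurable_fun setT (fun x => (cska k x).1) /\
  measurable_fun setT (fun x => (cska k x).2).
Proof.
elim: k => [|k [IH1 IH2]] /=; first by split; exact: measurable_cst.
by split; [apply: measurable_funB|apply: measurable_funD]; apply: measurable_funM => //;
  (exact: measurable_ca || exact: measurable_sa).
Qed.

(** The first-order change of the polar coordinates in the direction [base R j]:
    [rad j] is the partial derivative of the radius, [tau j] that of the angle
    multiplied by the radius.  They are also the components of e_R and e_theta. *)
Definition rad j x : R := if j == ord0 then ca x else sa x.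
Definition tau j x : R := if j == ord0 then - sa x else ca x.

Lemma pt_neq0 j (t s : R) : s != 0 -> pt j t s != 0.
Proof.
move=> s0; rewrite /pt; case: ifP => _; apply: contra s0 => /eqP h.
  by have /= -> := congr1 snd h.
by have /= -> := congr1 fst h.
Qed.

Section line.
Variables (j : 'I_2) (s : R).
Hypothesis s0 : s != 0.

Lemma is_derive_radius (t : R) :
  is_derive t 1 (fun t => radius (pt j t s)) (rad j (pt j t s)).
Proof.
have rE u : radius (pt j u s) = Num.sqrt (u ^+ 2 + s ^+ 2).
  by rewrite radiusE /pt; case: ifP => _ //=; rewrite addrC.
have p0 : 0 < t ^+ 2 + s ^+ 2 by rewrite ltr_wpDl ?sqr_ge0// exprn_even_gt0.
have d1 := is_deriveD (is_deriveX 2 (is_derive_id t 1)) (is_derive_cst (s ^+ 2) t 1).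
have d2 := @is_derive1_comp _ Num.sqrt _ t _ _ (is_derive1_sqrt p0) d1.
apply: (is_derive_ext d2) => [u|]; first by rewrite rE /= addrfctE exprfctE.
have -> : rad j (pt j t s) = t / radius (pt j t s).
  by rewrite /rad /ca /sa /pt; case: (j == ord0).
rewrite rE addr0 /GRing.scale/= expr1 mulr1.
have q0 : Num.sqrt (t ^+ 2 + s ^+ 2) != 0 by rewrite gt_eqF// sqrtr_gt0.
by field.
Qed.

Lemma is_derive_radiusV (t : R) :
  is_derive t 1 (fun t => (radius (pt j t s))^-1)
    (- rad j (pt j t s) / radius (pt j t s) ^+ 2).
Proof.
have r0 := radius_gt0 (pt_neq0 j t s0).
have rn0 : radius (pt j t s) != 0 by rewrite gt_eqF.
apply: (is_derive_ext (@is_deriveV _ (fun t => radius (pt j t s)) t _ 1 rn0 (is_derive_radius t))) => //.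
by rewrite /GRing.scale/= mulNr mulrC mulNr.
Qed.

Let th t := tau j (pt j t s) / radius (pt j t s).

Lemma is_derive_casa (t : R) :
  is_derive t 1 (fun t => ca (pt j t s)) (- sa (pt j t s) * th t) /\
  is_derive t 1 (fun t => sa (pt j t s)) (ca (pt j t s) * th t).
Proof.
have r0 := radius_gt0 (pt_neq0 j t s0).
have rn0 : radius (pt j t s) != 0 by rewrite gt_eqF.
have r2 : radius (pt j t s) ^+ 2 = t ^+ 2 + s ^+ 2.
  by rewrite radius_sqr /pt; case: ifP => _ //=; rewrite addrC.
have d1 := is_deriveM (is_derive_id t 1) (is_derive_radiusV t).
have d2 := is_deriveM (is_derive_cst s t 1) (is_derive_radiusV t).
rewrite /th /GRing.scale/=.
have e1 : t * (- (t / radius (pt j t s)) / radius (pt j t s) ^+ 2) +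
   (radius (pt j t s))^-1 = s ^+ 2 / radius (pt j t s) ^+ 3.
  have -> : s ^+ 2 = radius (pt j t s) ^+ 2 - t ^+ 2 by rewrite r2; ring.
  by field.
move: d1 d2; rewrite /rad /tau /ca /sa; rewrite /pt in rn0 e1 *.
case: ifPn => j0 d1 d2; rewrite ?j0 ?(negbTE j0) /= in d1 d2 rn0 e1 *; split.
- apply: (is_derive_ext d1) => //.
  by rewrite /GRing.scale/= mulr1 e1; field.
- apply: (is_derive_ext d2) => //.
  by rewrite /GRing.scale/= mulr0 addr0; field.
- apply: (is_derive_ext d2) => //.
  by rewrite /GRing.scale/= mulr0 addr0; field.
- apply: (is_derive_ext d1) => //.
  by rewrite /GRing.scale/= mulr1 e1; field.
Qed.

(** Induction with the addition formulas; [th] is the partial derivative of the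
    angle. *)
Lemma is_derive_cska k (t : R) :
  is_derive t 1 (fun t => (cska k (pt j t s)).1)
    (- (k%:R * (cska k (pt j t s)).2 * th t)) /\
  is_derive t 1 (fun t => (cska k (pt j t s)).2)
    (k%:R * (cska k (pt j t s)).1 * th t).
Proof.
elim: k => [|k [IH1 IH2]] /=.
  by rewrite !mul0r oppr0; split; exact: is_derive_cst.
have [d1 d2] := is_derive_casa t.
split.
- apply: (is_derive_ext (is_deriveB (is_deriveM d1 IH1) (is_deriveM d2 IH2))) => //.
  by rewrite /GRing.scale/= -nat1r; ring.
- apply: (is_derive_ext (is_deriveD (is_deriveM d2 IH1) (is_deriveM d1 IH2))) => //.
  by rewrite /GRing.scale/= -nat1r; ring.
Qed.

End line.

Definition isq k : R := (Num.sqrt k%:R)^-1.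

(** The tensor k^(-1/2) (e_R(k theta) (x) e_R + k e_theta(k theta) (x) e_theta). *)
Definition gradubar k x : 'M[R]_2 :=
  \matrix_(i, j) (isq k *
    (rad j x * (if i == ord0 then (cska k x).1 else (cska k x).2) +
     k%:R * tau j x * (if i == ord0 then - (cska k x).2 else (cska k x).1))).

Lemma ubarE k x i : ubar k x i ord0 =
  isq k * radius x * (if i == ord0 then (cska k x).1 else (cska k x).2).
Proof.
rewrite /ubar !mxE /isq; have [->|x0] := eqVneq x 0; last by rewrite cskaE.
have -> : radius (0 : R * R) = 0 by apply/eqP; rewrite radius_eq0.
by rewrite !mulr0 !mul0r.
Qed.

Lemma is_derive_ubar k i j (s t : R) : s != 0 ->
  is_derive t 1 (fun t => ubar k (pt j t s) i ord0) (gradubar k (pt j t s) i j).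
Proof.
move=> s0; have [d1 d2] := is_derive_cska j s0 k t.
have rn0 : radius (pt j t s) != 0 by rewrite gt_eqF// radius_gt0// pt_neq0.
have dr := is_derive_radius j s0 t.
rewrite mxE; case: (i =P ord0) => [->|/eqP i0].
- apply: (is_derive_ext (is_deriveZ (isq k) (is_deriveM dr d1))) => [u|].
    by rewrite ubarE /= /GRing.scale/= mulrA.
  rewrite /GRing.scale/=; congr (_ * _); by field; rewrite rn0.
- apply: (is_derive_ext (is_deriveZ (isq k) (is_deriveM dr d2))) => [u|].
    by rewrite ubarE /= (negbTE i0) /GRing.scale/= mulrA.
  rewrite /GRing.scale/=; congr (_ * _); by field; rewrite rn0.
Qed.

Lemma continuous_gradubar k i j (s : R) : s != 0 ->
  continuous (fun t => gradubar k (pt j t s) i j).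
Proof.
move=> s0 t; have c1 (w : R -> R) dw : is_derive t 1 w dw -> {for t, continuous w}.
  by move=> [h _]; apply: differentiable_continuous; apply/derivable1_diffP.
under eq_fun do rewrite mxE.
have [d1 d2] := is_derive_cska j s0 k t.
have [d3 d4] := is_derive_casa j s0 t.
apply: cvgM; first exact: cvg_cst.
apply: cvgD; apply: cvgM.
- by rewrite /rad; case: (j == ord0); [exact: c1 d3|exact: c1 d4].
- by case: (i == ord0); [exact: c1 d1|exact: c1 d2].
- apply: cvgM; first exact: cvg_cst.
  by rewrite /tau; case: (j == ord0); [exact: (c1 _ _ (is_deriveN d4))|exact: c1 d3].
- by case: (i == ord0); [exact: (c1 _ _ (is_deriveN d2))|exact: c1 d1].
Qed.

Lemma measurable_ubar k i : measurable_fun setT (fun x => ubar k x i ord0).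
Proof.
under eq_fun do rewrite ubarE.
have [h1 h2] := measurable_cska k.
apply: measurable_funM; last by case: (i == ord0).
by apply: measurable_funM => //; exact: measurable_radius.
Qed.

Lemma measurable_gradubar k i j : measurable_fun setT (fun x => gradubar k x i j).
Proof.
under eq_fun do rewrite mxE.
have [h1 h2] := measurable_cska k.
have h3 := measurable_ca; have h4 := measurable_sa.
apply: measurable_funM => //; apply: measurable_funD; apply: measurable_funM.
- by rewrite /rad; case: (j == ord0).
- by case: (i == ord0).
- apply: measurable_funM => //.
  by rewrite /tau; case: (j == ord0) => //; exact: measurable_funN.
- by case: (i == ord0) => //; exact: measurable_funN.
Qed.

Lemma gradubar_le k x i j : `|gradubar k x i j| <= `|isq k| * (1 + k%:R).
Proof.
have [h1 h2] := cska_le1 k x; have [h3 h4] := casa_le1 x.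
rewrite mxE normrM ler_wpM2l// (le_trans (ler_normD _ _))// lerD//.
  by rewrite normrM mulr_ile1// /rad; case: ifP.
rewrite !normrM normr_nat -mulrA -[leRHS]mulr1 ler_wpM2l//.
by rewrite mulr_ile1// /tau; case: ifP => _; rewrite ?normrN.
Qed.

Lemma ubar_le k r x i : disk r x -> `|ubar k x i ord0| <= `|isq k| * r.
Proof.
rewrite /disk /= => xr; have [h1 h2] := cska_le1 k x.
rewrite ubarE !normrM -mulrA ler_wpM2l// -[leRHS]mulr1 ler_pM//.
  by rewrite ger0_norm ?radius_ge0// ltW.
by case: ifP.
Qed.

Lemma ubar_inL2 k (r : R) i : 0 < r -> inL2 (disk r) (fun x => ubar k x i ord0).
Proof.
move=> r0; apply: (@inL2_bounded _ _ _ _ _ (`|isq k| * r)).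
- exact: measurable_disk.
- exact/measure_disk_fin/ltW.
- by apply: measurable_funTS; exact: measurable_ubar.
- by move=> x; exact: ubar_le.
Qed.

Lemma weak_grad_ubar k (r : R) : 0 < r ->
  is_weak_grad (disk r) (@ubar R k) (gradubar k).
Proof.
move=> r0 i j; split.
  apply: (@inL2_bounded _ _ _ _ _ (`|isq k| * (1 + k%:R))).
  - exact: measurable_disk.
  - exact/measure_disk_fin/ltW.
  - by apply: measurable_funTS; exact: measurable_gradubar.
  - by move=> x _; exact: gradubar_le.
pose M := `|isq k| * r + `|isq k| * (1 + k%:R).
have h1 : 0 <= `|isq k| * r by rewrite mulr_ge0// ltW.
have h2 : 0 <= `|isq k| * (1 + k%:R) by rewrite mulr_ge0// addr_ge0.
apply: (@weak_partial_lines _ r j _ _ M) => //.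
- by apply: measurable_funTS; exact: measurable_ubar.
- by apply: measurable_funTS; exact: measurable_gradubar.
- by move=> x xr; rewrite (le_trans (ubar_le _ _ xr))// lerDl.
- by move=> x xr; rewrite (le_trans (gradubar_le _ _ _ _))// lerDr.
- by move=> s s0 t; exact: is_derive_ubar.
- by move=> s s0; exact: continuous_gradubar.
Qed.

End polar_frame.

(** * Commuting derivatives and the Poincare inequality for test functions *)

Section calculus_on_test_functions.
Variable R : realType.
Notation mu := (plane_measure R).
Implicit Types (j : 'I_2) (r : R) (phi : R * R -> R).

(** The mean value theorem, once in each variable, applied to the mixed second
    difference of [phi].  The expression is symmetric in the two directions, so
    that both orders of differentiation are reached. *)
Lemma second_difference j j' phi (a b h : R) : 0 < h ->
  (forall t s, pt j t s = pt j' s t :> R * R) -> isC 2 phi ->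
  exists t s, [/\ a < t < a + h, b < s < b + h &
    phi (pt j (a + h) (b + h)) - phi (pt j (a + h) b) -
    (phi (pt j a (b + h)) - phi (pt j a b)) =
    'D_(base R j') ('D_(base R j) phi) (pt j t s) * h * h].
Proof.
move=> h0 jj' phiC.
have d1 s t : is_derive t (1 : R) (fun t => phi (pt j t s)) ('D_(base R j) phi (pt j t s)).
  split; [rewrite -derivable_line; exact: isC_derivable phiC|by rewrite -derive_line].
have d2 t s : is_derive s (1 : R) (fun s => 'D_(base R j) phi (pt j t s))
    ('D_(base R j') ('D_(base R j) phi) (pt j t s)).
  have d : is_derive s (1 : R) (fun s => 'D_(base R j) phi (pt j' s t))
      ('D_(base R j') ('D_(base R j) phi) (pt j' s t)).
    split; last by rewrite -(derive_line j' ('D_(base R j) phi)).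
    rewrite -(derivable_line j' ('D_(base R j) phi)).
    exact: (isC_derivable (isC_derive j phiC)).
  by apply: (is_derive_ext d) => [u|]; rewrite jj'.
have cont (w dw : R -> R) A : (forall t : R, is_derive t 1 w (dw t)) ->
    {within A, continuous w}.
  move=> dw'; apply: continuous_subspaceT => t; apply: differentiable_continuous.
  by apply/derivable1_diffP; have [] := dw' t.
have d3 t : is_derive t (1 : R) (fun t => phi (pt j t (b + h)) - phi (pt j t b))
    ('D_(base R j) phi (pt j t (b + h)) - 'D_(base R j) phi (pt j t b)).
  by apply: is_deriveB.
have [t tab ->] := MVT (ltac:(by rewrite ltrDl) : a < a + h) (fun t _ => d3 t) (cont _ _ _ d3).
have [s sab ->] := MVT (ltac:(by rewrite ltrDl) : b < b + h) (fun s _ => d2 t s) (cont _ _ _ (d2 t)).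
exists t, s; rewrite !in_itv/= in tab sab; split => //.
by rewrite ![_ + h - _]addrAC !subrr !add0r.
Qed.

Lemma eq_of_close_values (A B : R * R -> R) (p : R * R) :
  {for p, continuous A} -> {for p, continuous B} ->
  (forall h, 0 < h -> exists q q' : R * R,
    [/\ ball p h q, ball p h q' & A q = B q']) ->
  A p = B p.
Proof.
move=> cA cB close; apply/eqP; apply: contrapT => /negP ABp.
pose e := `|A p - B p| / 2.
have e0 : 0 < e by rewrite divr_gt0// normr_gt0 subr_eq0.
have /cvgrPdist_lt/(_ e e0)/nbhs_ballP[d1/= d10 d1A] := cA.
have /cvgrPdist_lt/(_ e e0)/nbhs_ballP[d2/= d20 d2B] := cB.
have h0 : 0 < Num.min d1 d2 by rewrite lt_min d10.
have [q [q' [pq pq' AB]]] := close _ h0.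
have a1 : `|A p - A q| < e.
  by apply: d1A; apply: (le_ball _ pq); rewrite ge_min lexx.
have b1 : `|B p - B q'| < e.
  by apply: d2B; apply: (le_ball _ pq'); rewrite ge_min lexx orbT.
have : `|A p - B p| < e + e.
  have -> : A p - B p = (A p - A q) - (B p - B q') by rewrite AB; ring.
  by rewrite (le_lt_trans (ler_normB _ _))// ltrD.
by rewrite /e -splitr ltxx.
Qed.

(** Schwarz's theorem: both mixed derivatives, taken at points arbitrarily close
    to [p], equal the same second difference quotient. *)
Lemma derive_comm phi p : isC 2 phi ->
  'D_(base R ord0) ('D_(base R ord_max) phi) p =
  'D_(base R ord_max) ('D_(base R ord0) phi) p.
Proof.
move=> phiC.
apply: (@eq_of_close_values _ _ p
  (isC_continuous (isC_derive ord0 (isC_derive ord_max phiC)) (x := p))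
  (isC_continuous (isC_derive ord_max (isC_derive ord0 phiC)) (x := p))) => h h0.
have [t [s [tab sab E1]]] := @second_difference ord0 ord_max phi p.1 p.2 h h0 (fun _ _ => erefl) phiC.
have [t' [s' [tab' sab' E2]]] := @second_difference ord_max ord0 phi p.2 p.1 h h0 (fun _ _ => erefl) phiC.
have near (c u : R) : c < u < c + h -> ball c h u.
  by move=> /andP[u1 u2]; rewrite /ball/= distrC gtr0_norm ?subr_gt0// ltrBlDl.
exists (s', t'), (t, s); split; [by split; exact: near|by split; exact: near|].
have key (z1 z2 z3 z4 x y : R) : z1 - z2 - (z3 - z4) = x * h * h ->
    z1 - z3 - (z2 - z4) = y * h * h -> y = x.
  have hn0 : h != 0 by rewrite gt_eqF.
  by move=> e1 e2; apply: (mulIf hn0); apply: (mulIf hn0); rewrite -e1 -e2; ring.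
exact: key E1 E2.
Qed.

Section disk_calculus.
Variable r : R.
Hypothesis r0 : 0 < r.
Let U : set (R * R) := disk r.
Let mU : measurable U. Proof. exact: measurable_disk. Qed.
Let finU : (mu U < +oo)%E. Proof. exact/measure_disk_fin/ltW. Qed.

Lemma integral_sub_eq0 (F G : R * R -> R) :
  mu.-integrable U (fun x => (F x)%:E) -> mu.-integrable U (fun x => (G x)%:E) ->
  (\int[mu]_(x in U) (F x)%:E = \int[mu]_(x in U) (G x)%:E)%E ->
  (\int[mu]_(x in U) (F x - G x)%:E = 0)%E.
Proof.
move=> iF iG FG; under eq_integral do rewrite EFinB.
rewrite (@integralB _ _ _ mu _ mU _ _ iF iG) FG subee//.
exact: (@integrable_fin_num _ _ _ mu _ mU _ iG).
Qed.

(** If d0 and d1 are the two weak derivatives of v, both integrals equal, up to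
    the sign, the integral of v against a mixed second derivative of [phi]. *)
Lemma weak_curl_free (v d0 d1 : R * R -> R) phi :
  inL2 U d0 -> inL2 U d1 ->
  weak_partial U ord0 v d0 -> weak_partial U ord_max v d1 -> test_fun U phi ->
  (\int[mu]_(x in U) (d0 x * 'D_(base R ord_max) phi x -
                      d1 x * 'D_(base R ord0) phi x)%:E = 0)%E.
Proof.
move=> L0 L1 w0 w1 tphi.
have t0 := test_fun_derive ord0 tphi; have t1 := test_fun_derive ord_max tphi.
have i0 := inL2M mU L0 (inL2_test mU finU t1).
have i1 := inL2M mU L1 (inL2_test mU finU t0).
have [phiC _ _] := tphi.
have := w0 _ t1; under eq_integral do rewrite (derive_comm _ (phiC 2%N)).
rewrite (w1 _ t0) => /oppe_inj e.
exact: integral_sub_eq0 i0 i1 (esym e).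
Qed.

(** Integrate phi^2 d(x_1)/dx_1 by parts and bound x_1 by the radius of the disk;
    half of the integral of phi^2 is absorbed on the left. *)
Lemma poincare_test phi : test_fun U phi ->
  (\int[mu]_(x in U) (phi x ^+ 2)%:E <=
   (4 * r ^+ 2)%:E * \int[mu]_(x in U) ('D_(base R ord0) phi x ^+ 2)%:E)%E.
Proof.
move=> tphi; have td := test_fun_derive ord0 tphi.
have [phiC _ _] := tphi.
have tphi2 : test_fun U (fun x => phi x * phi x) by exact: test_funM.
have [mp ip] := inL2_test mU finU tphi.
have [md id] := inL2_test mU finU td.
have ixp : mu.-integrable U (fun x => (x.1 * (2 * (phi x * 'D_(base R ord0) phi x)))%:E).
  apply: inL2M => //.
    apply: (@inL2_bounded _ _ _ _ _ r) => //.
      by apply: measurable_funTS; exact: measurable_fst.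
    by move=> x xr; rewrite (le_trans (ler_fst_radius x))// ltW.
  apply: inL2Z => //; apply: inL2_test => //; apply: test_funM => // n.
  exact/isC_derive/phiC.
have /(_ _ tphi2) wp : weak_partial U ord0 fst (fun=> 1).
  apply: (@weak_partial_lines _ r ord0 _ _ (r + 1)) => //.
  - by apply: measurable_funTS; exact: measurable_fst.
  - by move=> x xr; rewrite (le_trans (ler_fst_radius x))// (le_trans (ltW xr))// lerDl.
  - by move=> x _; rewrite normr1 lerDr ltW.
  - by move=> s _ t; exact: cvg_cst.
have e : (\int[mu]_(x in U) (x.1 * (2 * (phi x * 'D_(base R ord0) phi x)))%:E =
    - \int[mu]_(x in U) (phi x ^+ 2)%:E)%E.
  transitivity (- \int[mu]_(x in U) (1 * (phi x * phi x))%:E)%E; last first.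
    by congr (- _)%E; apply: eq_integral => x _; rewrite mul1r expr2.
  rewrite -wp; apply: eq_integral => x _; congr (_ * _)%:E.
  have dp : derivable phi x (base R ord0) by exact: isC_derivable (phiC 1%N).
  by have := deriveM dp dp; rewrite /GRing.scale/= => ->; ring.
have fp := @integrable_fin_num _ _ _ mu _ mU _ ip.
have fd := @integrable_fin_num _ _ _ mu _ mU _ id.
have i1 := @integrableZl _ _ _ mu _ mU (2^-1) _ ip.
have i2 := @integrableZl _ _ _ mu _ mU (2 * r ^+ 2) _ id.
have i3 := @integrableD _ _ _ mu _ mU _ _ i1 i2.
have : (0 <= \int[mu]_(x in U) ((2^-1)%:E * (phi x ^+ 2)%:E +
    (2 * r ^+ 2)%:E * ('D_(base R ord0) phi x ^+ 2)%:E +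
    (x.1 * (2 * (phi x * 'D_(base R ord0) phi x)))%:E))%E.
  apply: integral_ge0 => x xU; rewrite -!EFinM -!EFinD lee_fin.
  have xr : x.1 ^+ 2 <= r ^+ 2.
    rewrite -(real_normK (num_real x.1)) lerXn2r ?nnegrE//; first exact: ltW.
    by rewrite (le_trans (ler_fst_radius x))// ltW.
  move: (phi x) ('D_(base R ord0) phi x) => p q.
  (* this square says that - 2 x p q is at most p^2 / 2 + 2 x^2 q^2 *)
  have := sqr_ge0 (p + 2 * x.1 * q).
  have : x.1 ^+ 2 * q ^+ 2 <= r ^+ 2 * q ^+ 2 by rewrite ler_wpM2r// sqr_ge0.
  nra.
rewrite (@integralD _ _ _ mu _ mU _ _ i3 ixp) (@integralD _ _ _ mu _ mU _ _ i1 i2).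
rewrite (@integralZl _ _ _ mu _ mU _ ip) (@integralZl _ _ _ mu _ mU _ id) e.
rewrite -(fineK fp) -(fineK fd) -!EFinM -!EFinN -!EFinD !lee_fin.
move: (fine _) (fine _) => I J; nra.
Qed.

End disk_calculus.
End calculus_on_test_functions.

(** * The quadratic form of the energy *)

Section gradient_fields.
Variable R : realType.
Notation mu := (plane_measure R).
Implicit Types (u v w : R * R -> 'cV[R]_2) (D W : R * R -> 'M[R]_2).

Lemma ae_and (P Q S : R * R -> Prop) : {ae mu, forall x, P x} ->
  {ae mu, forall x, Q x} -> (forall x, P x -> Q x -> S x) -> {ae mu, forall x, S x}.
Proof.
move=> aP aQ PQS; have : mu.-negligible (~` P `|` ~` Q) by exact: negligibleU.
apply: negligibleS => x /= Sx; apply: contrapT => /not_orP[/contrapT Px /contrapT Qx].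
exact/Sx/PQS.
Qed.

Lemma ae_imp (P S : R * R -> Prop) : {ae mu, forall x, P x} ->
  (forall x, P x -> S x) -> {ae mu, forall x, S x}.
Proof. by move=> aP PS; apply: negligibleS aP => x /= Sx /PS. Qed.

Lemma ae_plane_neq0 : {ae mu, forall x, x != 0}.
Proof.
have : mu.-negligible [set (0 : R * R)].
  rewrite (_ : [set 0] = [set 0] `*` [set 0] :> set (R * R)); last first.
    by apply/seteqP; split => [_ -> //|[c d] [/= -> ->]].
  exists ([set 0] `*` [set 0]); split => //.
    by apply: measurableX; exact: measurable_set1.
  rewrite product_measure1E//; try exact: measurable_set1.
  by rewrite [X in (X * _)%E](lebesgue_measure_set1 (0 : R)) mul0e.
by apply: negligibleS => x /= /negP; rewrite negbK => /eqP.
Qed.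

Lemma mxdot_cV (a b : 'cV[R]_2) :
  mxdot a b = a ord0 ord0 * b ord0 ord0 + a ord_max ord0 * b ord_max ord0.
Proof.
rewrite /mxdot /mxtrace big_ord1 mxE !big_ord_recl big_ord0 !mxE addr0.
by congr (_ + a _ _ * b _ _); exact: val_inj.
Qed.

Lemma mxdot_M (A B : 'M[R]_2) :
  mxdot A B = A ord0 ord0 * B ord0 ord0 + A ord_max ord0 * B ord_max ord0 +
    (A ord0 ord_max * B ord0 ord_max + A ord_max ord_max * B ord_max ord_max).
Proof.
rewrite /mxdot /mxtrace !big_ord_recl big_ord0 !mxE !big_ord_recl !big_ord0 !mxE !addr0.
have -> : lift ord0 ord0 = ord_max :> 'I_2 by exact: val_inj.
by [].
Qed.

Lemma mxdot_ge0 m n (A : 'M[R]_(m, n)) : 0 <= mxdot A A.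
Proof.
rewrite /mxdot /mxtrace; apply: sumr_ge0 => i _; rewrite mxE; apply: sumr_ge0 => j _.
by rewrite mxE -expr2 sqr_ge0.
Qed.

Lemma mxnorm_sqr m n (A : 'M[R]_(m, n)) : mxnorm A ^+ 2 = mxdot A A.
Proof. by rewrite sqr_sqrtr ?mxdot_ge0. Qed.

Lemma mxnorm0 m n : mxnorm (0 : 'M[R]_(m, n)) = 0.
Proof. by rewrite /mxnorm /mxdot mulmx0 mxtrace0 sqrtr0. Qed.

Lemma mulmx_cvec (A : 'M[R]_2) (a b : R) i :
  (A *m cvec a b) i ord0 = A i ord0 * a + A i ord_max * b.
Proof.
rewrite mxE !big_ord_recl big_ord0 !mxE addr0 /=.
by congr (_ + A _ _ * _); exact: val_inj.
Qed.

Lemma I2P (P : 'I_2 -> Prop) : P ord0 -> P ord_max -> forall i, P i.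
Proof.
move=> h0 h1 i; have [->//|->//] : i = ord0 \/ i = ord_max.
by case: i => -[|[|//]] ?; [left|right]; exact: val_inj.
Qed.

(** The bilinear form of the energy density. *)
Definition Qform k D W (x : R * R) : R :=
  k%:R ^+ 2 * mxdot (dR D x) (dR W x) + mxdot (dtau D x) (dtau W x).

Lemma dRE D x i : dR D x i ord0 =
  D x i ord0 * cos (angle x) + D x i ord_max * sin (angle x).
Proof. exact: mulmx_cvec. Qed.

Lemma dtauE D x i : dtau D x i ord0 =
  D x i ord0 * - sin (angle x) + D x i ord_max * cos (angle x).
Proof. exact: mulmx_cvec. Qed.

Lemma QformE k D W x : Qform k D W x =
  \sum_i (k%:R ^+ 2 * (dR D x i ord0 * dR W x i ord0) +
          dtau D x i ord0 * dtau W x i ord0).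
Proof.
rewrite /Qform !mxdot_cV !big_ord_recl big_ord0 addr0.
have -> : lift ord0 ord0 = ord_max :> 'I_2 by exact: val_inj.
ring.
Qed.

Lemma Qform_ge0 k D x : 0 <= Qform k D D x.
Proof. by rewrite /Qform addr_ge0// ?mulr_ge0 ?mxdot_ge0 ?exprn_ge0. Qed.

(** The vectors e_R and e_theta form an orthonormal basis, so the squared norm of
    [D x] is the sum of the two squares that [Qform] weights by k^2 and 1. *)
Lemma Qform_le k D x : Qform k D D x <= (k%:R ^+ 2 + 1) * mxnorm (D x) ^+ 2.
Proof.
rewrite QformE mxnorm_sqr mxdot_M !big_ord_recl big_ord0 addr0.
have -> : lift ord0 ord0 = ord_max :> 'I_2 by exact: val_inj.
rewrite !dRE !dtauE; have := cos2Dsin2 (angle x).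
set c := cos _; set s := sin _ => cs.
have h (a b : R) : k%:R ^+ 2 * ((a * c + b * s) * (a * c + b * s)) +
    (a * - s + b * c) * (a * - s + b * c) <= (k%:R ^+ 2 + 1) * (a * a + b * b).
  have e : (k%:R ^+ 2 + 1) * (a * a + b * b) =
    k%:R ^+ 2 * ((a * c + b * s) * (a * c + b * s)) +
    (a * - s + b * c) * (a * - s + b * c) +
    (k%:R ^+ 2 * (a * - s + b * c) ^+ 2 + (a * c + b * s) ^+ 2).
    rewrite -[LHS]mulr1 -[X in _ * X = _]cs; ring.
  by rewrite e lerDl addr_ge0// ?sqr_ge0// mulr_ge0 ?sqr_ge0.
by apply: (le_trans (lerD (h _ _) (h _ _))); rewrite le_eqVlt; apply/orP; left; apply/eqP; ring.
Qed.

Lemma Qform_ge_mxnorm k D x : (1 <= k)%N -> mxnorm (D x) ^+ 2 <= Qform k D D x.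
Proof.
move=> k1; rewrite QformE mxnorm_sqr mxdot_M !big_ord_recl big_ord0 addr0.
have -> : lift ord0 ord0 = ord_max :> 'I_2 by exact: val_inj.
rewrite !dRE !dtauE; have := cos2Dsin2 (angle x).
set c := cos _; set s := sin _ => cs.
have k2 : 0 <= k%:R ^+ 2 - 1 :> R by rewrite subr_ge0 exprn_ege1// ler1n.
have h (a b : R) : a * a + b * b <= k%:R ^+ 2 * ((a * c + b * s) * (a * c + b * s)) +
    (a * - s + b * c) * (a * - s + b * c).
  have e : k%:R ^+ 2 * ((a * c + b * s) * (a * c + b * s)) +
    (a * - s + b * c) * (a * - s + b * c) =
    (a * a + b * b) * (c ^+ 2 + s ^+ 2) + (k%:R ^+ 2 - 1) * (a * c + b * s) ^+ 2 by ring.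
  by rewrite e cs mulr1 lerDl mulr_ge0// sqr_ge0.
by apply: le_trans (lerD (h _ _) (h _ _)); rewrite le_eqVlt; apply/orP; left; apply/eqP; ring.
Qed.

(** Young's inequality with a free parameter; it plays the role of the
    Cauchy-Schwarz inequality after integration. *)
Lemma Qform_norm_le k D W x (e : R) : 0 < e ->
  `|Qform k D W x| <= e / 2 * Qform k D D x + (2 * e)^-1 * Qform k W W x.
Proof.
move=> e0; rewrite !QformE !big_ord_recl !big_ord0 !addr0.
set l := lift ord0 ord0.
move: (dR D x ord0 ord0) (dR D x l ord0) (dR W x ord0 ord0) (dR W x l ord0).
move: (dtau D x ord0 ord0) (dtau D x l ord0) (dtau W x ord0 ord0) (dtau W x l ord0).
move=> d d' w w' a a' b b'.
have y (p q : R) : `|p * q| <= e / 2 * (p * p) + (2 * e)^-1 * (q * q).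
  have [h1 h2] : 0 <= (2 * e)^-1 * (e * p - q) ^+ 2 /\ 0 <= (2 * e)^-1 * (e * p + q) ^+ 2.
    by split; rewrite mulr_ge0 ?sqr_ge0// invr_ge0 mulr_ge0 ?ltW.
  have E1 : (2 * e)^-1 * (e * p - q) ^+ 2 = e / 2 * (p * p) + (2 * e)^-1 * (q * q) - p * q.
    by field; rewrite gt_eqF.
  have E2 : (2 * e)^-1 * (e * p + q) ^+ 2 = e / 2 * (p * p) + (2 * e)^-1 * (q * q) + p * q.
    by field; rewrite gt_eqF.
  by rewrite ler_norml; move: h1 h2; rewrite E1 E2; lra.
have k2 : 0 <= k%:R ^+ 2 :> R by rewrite sqr_ge0.
have kk (p q : R) : `|k%:R ^+ 2 * (p * q)| <= k%:R ^+ 2 * (e / 2 * (p * p) + (2 * e)^-1 * (q * q)).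
  by rewrite normrM ger0_norm// ler_wpM2l.
rewrite (le_trans (ler_normD _ _))//.
apply: (le_trans (lerD (le_trans (ler_normD _ _) (lerD (kk a b) (y d w)))
  (le_trans (ler_normD _ _) (lerD (kk a' b') (y d' w'))))).
by rewrite le_eqVlt; apply/orP; left; apply/eqP; ring.
Qed.

Lemma QformDr k D W W' x :
  Qform k D (fun x => W x + W' x) x = Qform k D W x + Qform k D W' x.
Proof.
rewrite !QformE -big_split/=; apply: eq_bigr => i _.
by rewrite !dRE !dtauE !mxE; ring.
Qed.

Lemma Qform_sqrD k D W x :
  Qform k (fun x => D x + W x) (fun x => D x + W x) x =
  Qform k D D x + 2 * Qform k D W x + Qform k W W x.
Proof.
rewrite !QformE mulr_sumr -!big_split/=; apply: eq_bigr => i _.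
by rewrite !dRE !dtauE !mxE; ring.
Qed.

Lemma measurable_plane_set1 (p : R * R) : measurable [set p].
Proof.
rewrite (_ : [set p] = [set p.1] `*` [set p.2]); last first.
  by apply/seteqP; case: p => a b; split => [_ -> //|[c d] [/= -> ->]].
by apply: measurableX; exact: measurable_set1.
Qed.

(** The polar angle has a conventional value at the origin, where it need not agree
    with x / R. *)
Lemma measurable_off0 (h g : R * R -> R) : measurable_fun setT g ->
  (forall x, x != 0 -> h x = g x) -> measurable_fun setT h.
Proof.
move=> mg hg.
rewrite (_ : h = (fun x => g x + (h 0 - g 0) * \1_[set 0] x)).
  apply: measurable_funD => //; apply: measurable_funM => //.
  by apply: measurable_indic; exact: measurable_plane_set1.
apply/funext => x; rewrite indicE; have [->|x0] := eqVneq x 0.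
  by rewrite mem_set//= mulr1 addrC subrK.
by rewrite memNset ?mulr0 ?addr0 ?hg// => /= /eqP; rewrite (negbTE x0).
Qed.

Lemma measurable_cos_angle : measurable_fun setT (fun x : R * R => cos (angle x)).
Proof. by apply: (measurable_off0 (@measurable_ca R)) => x; exact: caE. Qed.

Lemma measurable_sin_angle : measurable_fun setT (fun x : R * R => sin (angle x)).
Proof. by apply: (measurable_off0 (@measurable_sa R)) => x; exact: saE. Qed.

Section on_set.
Variable U : set (R * R).
Hypothesis mU : measurable U.
Hypothesis finU : (mu U < +oo)%E.

Definition L2field D := forall i j, inL2 U (fun x => D x i j).

Lemma inL2_mul_le1 (f h : R * R -> R) : inL2 U f -> measurable_fun setT h ->
  (forall x, `|h x| <= 1) -> inL2 U (fun x => f x * h x).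
Proof.
move=> [mf if2] mh h1; have mfh : measurable_fun U (fun x => f x * h x).
  by apply: measurable_funM => //; exact: measurable_funTS.
split => //; apply: (@le_integrable _ _ _ mu U mU _ (fun x => (f x ^+ 2)%:E)) => //.
  by apply/measurable_EFinP; exact: measurable_funX.
move=> x _; rewrite !abse_EFin lee_fin !ger0_norm ?sqr_ge0// exprMn ler_piMr ?sqr_ge0//.
by rewrite -(real_normK (num_real (h x))) exprn_ile1.
Qed.

Lemma inL2_dR D i : L2field D -> inL2 U (fun x => dR D x i ord0).
Proof.
move=> DL; under eq_fun do rewrite dRE.
apply: inL2D => //; apply: inL2_mul_le1 => //.
- exact: measurable_cos_angle.
- by move=> x; rewrite ler_norml cos_geN1 cos_le1.
- exact: measurable_sin_angle.
- by move=> x; rewrite ler_norml sin_geN1 sin_le1.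
Qed.

Lemma inL2_dtau D i : L2field D -> inL2 U (fun x => dtau D x i ord0).
Proof.
move=> DL; under eq_fun do rewrite dtauE.
apply: inL2D => //; apply: inL2_mul_le1 => //.
- by apply: measurable_funN; exact: measurable_sin_angle.
- by move=> x; rewrite normrN ler_norml sin_geN1 sin_le1.
- exact: measurable_cos_angle.
- by move=> x; rewrite ler_norml cos_geN1 cos_le1.
Qed.

Lemma Qform_integrable k D W : L2field D -> L2field W ->
  mu.-integrable U (fun x => (Qform k D W x)%:E).
Proof.
move=> DL WL.
rewrite (_ : (fun x => _) = (fun x => \sum_(i <- enum 'I_2)
   (((k%:R ^+ 2)%:E * (dR D x i ord0 * dR W x i ord0)%:E) +
     (dtau D x i ord0 * dtau W x i ord0)%:E))%E).
  apply: (@integrable_sum _ _ _ mu _ mU) => i _.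
  apply: (@integrableD _ _ _ mu _ mU).
    by apply: (@integrableZl _ _ _ mu _ mU); apply: inL2M => //; exact: inL2_dR.
  by apply: inL2M => //; exact: inL2_dtau.
apply/funext => x; rewrite QformE big_enum /= -sumEFin.
by apply: eq_bigr => i _; rewrite EFinD EFinM.
Qed.

Lemma L2fieldD D W : L2field D -> L2field W -> L2field (fun x => D x + W x).
Proof. by move=> DL WL i j; under eq_fun do rewrite mxE; exact: inL2D. Qed.

Lemma L2fieldB D W : L2field D -> L2field W -> L2field (fun x => D x - W x).
Proof. by move=> DL WL i j; under eq_fun do rewrite !mxE; exact: inL2B. Qed.

Lemma integral_Qform_sqrD k D W : L2field D -> L2field W ->
  (\int[mu]_(x in U) (Qform k (fun x => D x + W x)%R (fun x => D x + W x)%R x)%:E =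
   \int[mu]_(x in U) (Qform k D D x)%:E +
   2%:E * \int[mu]_(x in U) (Qform k D W x)%:E +
   \int[mu]_(x in U) (Qform k W W x)%:E)%E.
Proof.
move=> DL WL.
have i1 := Qform_integrable k DL DL.
have i2 := Qform_integrable k DL WL.
have i3 := Qform_integrable k WL WL.
have i4 := @integrableZl _ _ _ mu _ mU 2 _ i2.
have i5 := @integrableD _ _ _ mu _ mU _ _ i1 i4.
rewrite -(@integralZl _ _ _ mu _ mU _ i2) -(@integralD _ _ _ mu _ mU _ _ i1 i4).
rewrite -(@integralD _ _ _ mu _ mU _ _ i5 i3).
by apply: eq_integral => x _; rewrite Qform_sqrD !EFinD EFinM.
Qed.

Lemma integral_Qform_eq k D D' W W' : L2field D -> L2field D' ->
  L2field W -> L2field W' ->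
  {ae mu, forall x, U x -> D x = D' x} -> {ae mu, forall x, U x -> W x = W' x} ->
  (\int[mu]_(x in U) (Qform k D W x)%:E = \int[mu]_(x in U) (Qform k D' W' x)%:E)%E.
Proof.
move=> DL DL' WL WL' DD' WW'.
apply: (@ae_eq_integral _ _ _ mu _ _ _ mU).
- exact: (measurable_int mu (Qform_integrable k DL WL)).
- exact: (measurable_int mu (Qform_integrable k DL' WL')).
- apply: (ae_and DD' WW') => x h1 h2 Ux.
  by rewrite /Qform /dR /dtau h1// h2.
Qed.

End on_set.
End gradient_fields.

(** * Integrability of the logarithm and finiteness of G *)

Section energy_finite.
Variable R : realType.
Notation mu := (plane_measure R).

(** The series counts the integers n with n <= - ln t. *)
Lemma lnV_le_series (t : R) : 0 < t ->
  ((- ln t)%:E <= \sum_(n <oo) ((t <= expR (- n%:R))%R%:R)%:E)%E.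
Proof.
move=> t0; have pos (n : nat) : (0 <= n)%N -> true ->
    (0 <= ((t <= expR (- n%:R))%R%:R : R)%:E)%E by rewrite lee_fin.
have [l0|l0] := leP (- ln t) 0.
  by apply: (@le_trans _ _ 0%E); [rewrite lee_fin|exact: nneseries_ge0].
pose N := (Num.truncn (- ln t)).+1.
apply: le_trans (nneseries_lim_ge N pos).
rewrite (eq_big_nat _ _ (F2 := fun=> 1%E)); last first.
  move=> n /andP[_ nN]; rewrite (_ : (t <= _) = true)//.
  rewrite -{1}(lnK (_ : t \in Num.pos))// ler_expR lerNr.
  have /andP[h _] := truncn_itv (ltW l0).
  by apply: le_trans h; rewrite ler_nat -ltnS.
rewrite big_mkord sumEFin lee_fin big_const_ord iter_addr addr0.
by have /andP[_ /ltW] := truncn_itv (ltW l0).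
Qed.

(** By [lnV_le_series] the negative part of ln R is at most a sum of indicators of
    disks of radii exp(-n), whose areas decrease geometrically. *)
Lemma ln_radius_integrable (r : R) : 0 < r ->
  mu.-integrable (disk r) (fun x => (ln (radius x))%:E).
Proof.
move=> r0; have mU := @measurable_disk R r.
have finU := measure_disk_fin (ltW r0).
have ml : measurable_fun (disk r) (fun x : R * R => ln (radius x)).
  apply: measurable_funTS; apply: measurableT_comp; first exact: measurable_ln.
  exact: measurable_radius.
pose A (n : nat) : set (R * R) := [set x | radius x <= expR (- n%:R)].
have mA n : measurable (A n).
  rewrite (_ : A n = (@Defs.radius R) @^-1` [set t | t <= expR (- n%:R)])//.
  rewrite -[X in measurable X]setTI; apply: measurable_radius => //.
  rewrite (_ : [set t | _] = `]-oo, expR (- n%:R)]%classic); first exact: measurable_itv.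
  by apply/seteqP; split => t /=; rewrite in_itv.
(* the ratio of the areas of two successive squares *)
pose z : R := expR (-1) ^+ 2.
have z0 : 0 < z by rewrite exprn_gt0// expR_gt0.
have z1 : `|z| < 1.
  by rewrite gtr0_norm// exprn_ilt1// ?expR_ge0// -expR0 ltr_expR ltrN10.
(* [A n] lies in the open disk of radius 2 exp(-n), hence in a square of side 4 exp(-n) *)
have muA n : (mu (A n `&` disk r) <= (geometric 16 z n)%:E)%E.
  apply: (@le_trans _ _ (mu (disk (2 * expR (- n%:R))))).
    apply: le_measure; rewrite ?inE; [exact: (measurableI _ _ (mA n) mU)|exact: measurable_disk|].
    move=> x [/= xA _]; rewrite /disk /= (le_lt_trans xA)// mulr_natl mulr2n ltrDl.
    exact: expR_gt0.
  apply: (le_trans (measure_disk_le _)).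
    by rewrite mulr_ge0// expR_ge0.
  have -> : expR (- n%:R) = expR (-1) ^+ n :> R by rewrite -expRM_natl mulrN1.
  rewrite lee_fin /geometric/= /z exprAC le_eqVlt; apply/orP; left; apply/eqP; ring.
have mI n : measurable_fun (disk r) (fun x => (\1_(A n) x : R)%:E).
  by apply/measurable_EFinP; exact: (measurable_indic (mA n)).
have mS : measurable_fun (disk r) (fun x => \sum_(n <oo) (\1_(A n) x : R)%:E)%E.
  exact: (@ge0_emeasurable_sum _ _ _ _ (fun n x => (\1_(A n) x : R)%:E) xpredT).
have intS : (\int[mu]_(x in disk r) (\sum_(n <oo) (\1_(A n) x)%:E) < +oo)%E.
  rewrite integral_nneseries//.
  apply: (@le_lt_trans _ _ (16 / (1 - z))%:E); last exact: ltry.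
  apply: lime_le; first by apply: is_cvg_nneseries => n _ _; exact: integral_ge0.
  apply: nearW => N.
  apply: (@le_trans _ _ (series (geometric 16 z) N)%:E); last first.
    by rewrite lee_fin; exact: geometric_le_lim.
  rewrite /series/= -sumEFin; apply: lee_sum => n _.
  by rewrite integral_indic; [exact: muA|exact: mU|exact: mA].
apply/(@integrableP _ _ _ mu); split; first exact/measurable_EFinP.
apply: (@le_lt_trans _ _ (\int[mu]_(x in disk r)
    (`|ln r|%:E + \sum_(n <oo) (\1_(A n) x)%:E))%E).
  apply: ge0_le_integral => //.
  - by apply: measurableT_comp => //; exact/measurable_EFinP.
  - by apply: emeasurable_funD; first exact: measurable_cst.
  move=> x /= xr.
  have S0 : (0 <= \sum_(n <oo) (\1_(A n) x : R)%:E)%E by exact: nneseries_ge0.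
  have [x0|x0] := eqVneq x 0.
    have -> : ln (radius x) = 0.
      by apply: ln0; rewrite x0; have /eqP -> : radius (0 : R * R) == 0 by rewrite radius_eq0.
    by rewrite normr0 adde_ge0// lee_fin.
  have R0 := radius_gt0 x0.
  have [h|h] := leP 0 (ln (radius x)).
    rewrite ger0_norm//; apply: (@le_trans _ _ (`|ln r|%:E + 0)%E); last by rewrite leeD2l.
    rewrite adde0 lee_fin (le_trans _ (ler_norm _))// ler_ln ?posrE//; exact: ltW.
  rewrite ltr0_norm//; apply: (@le_trans _ _ (0 + \sum_(n <oo) (\1_(A n) x : R)%:E)%E).
    rewrite add0e; apply: (le_trans (lnV_le_series R0)).
    rewrite (eq_eseriesr (g := fun n => (\1_(A n) x : R)%:E))// => n _.
    by rewrite indicE; congr ((nat_of_bool _)%:R)%:E; apply/idP/idP; rewrite inE.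
  by rewrite leeD2r// lee_fin.
rewrite ge0_integralD//.
- rewrite (@integral_cst _ _ _ mu _ mU) lte_add_pinfty//.
  by rewrite lte_mul_pinfty// lee_fin.
- by move=> x _; apply: nneseries_ge0.
Qed.

Lemma det_mx2 (A : 'M[R]_2) : \det A =
  A ord0 ord0 * A ord_max ord_max - A ord0 ord_max * A ord_max ord0.
Proof.
rewrite (expand_det_row _ ord0) !big_ord_recl big_ord0 /cofactor !det_mx11 !mxE /=.
have -> : lift ord0 ord0 = ord_max :> 'I_2 by exact: val_inj.
have -> : lift ord_max 0 = ord0 :> 'I_2 by exact: val_inj.
by rewrite expr0 expr1 mul1r addr0 mulN1r mulrN.
Qed.

Lemma isq_sqr k : (0 < k)%N -> isq R k ^+ 2 = k%:R^-1.
Proof. by move=> k0; rewrite /isq exprVn sqr_sqrtr. Qed.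

(** The images of e_R and e_theta are orthogonal with norms k^(-1/2) and k^(1/2). *)
Lemma det_gradubar k (x : R * R) : (0 < k)%N -> x != 0 -> \det (gradubar k x) = 1.
Proof.
move=> k0 x0; rewrite det_mx2 !mxE /rad /tau /=.
have h1 := casa_sqr x0; have h2 := cska_sqr k x0.
transitivity (isq R k ^+ 2 * k%:R * (ca x ^+ 2 + sa x ^+ 2) *
  ((cska k x).1 ^+ 2 + (cska k x).2 ^+ 2)); first by ring.
by rewrite h1 h2 !mulr1 isq_sqr// mulVf// pnatr_eq0 -lt0n.
Qed.

Lemma mxnorm_gradubar k (x : R * R) : (0 < k)%N -> x != 0 ->
  mxnorm (gradubar k x) = tk R k.
Proof.
move=> k0 x0; have h1 := casa_sqr x0; have h2 := cska_sqr k x0.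
rewrite /mxnorm /tk -[(Num.sqrt k%:R)^-1]/(isq R k).
have i0 : 0 <= isq R k by rewrite invr_ge0 sqrtr_ge0.
rewrite -[isq R k in RHS]ger0_norm// -sqrtr_sqr -sqrtrM ?sqr_ge0//.
congr Num.sqrt; rewrite mxdot_M !mxE /rad /tau /=.
transitivity (isq R k ^+ 2 * (1 * (ca x ^+ 2 + sa x ^+ 2) + k%:R ^+ 2 * (ca x ^+ 2 + sa x ^+ 2)) *
  ((cska k x).1 ^+ 2 + (cska k x).2 ^+ 2)); first by ring.
by rewrite h1 h2 !mulr1.
Qed.

(** Where [D] is the gradient of [ubar], [gamma] is constant and the determinant is
    1, so that the integrand is a constant plus a multiple of ln R.  On the
    norms of matrices [f] is measurable because it is continuous on ]0, +oo[. *)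
Lemma G_fin_num (f : R -> R) k (r : R) (D : R * R -> 'M[R]_2) : 0 < r -> (0 < k)%N ->
  (forall t : R, 0 < t -> derivable f t 1) ->
  L2field (disk r) D ->
  {ae mu, forall x, disk r x -> D x = gradubar k x} ->
  (\int[mu]_(x in disk r) (gamma f (D x) + lambda f k * ln (radius x) * \det (D x))%:E)%E
    \is a fin_num.
Proof.
move=> r0 k0 df DL DE; have mU := @measurable_disk R r.
have finU := measure_disk_fin (ltW r0).
have mD i j : measurable_fun (disk r) (fun x => D x i j) by have [] := DL i j.
have il := ln_radius_integrable r0.
have ic : mu.-integrable (disk r) (fun=> (f (tk R k))%:E).
  apply: (@bounded_integrable _ _ mU finU (fun=> f (tk R k)) `|f (tk R k)|) => //.
have i1 := @integrableZl _ _ _ mu _ mU (lambda f k) _ il.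
have i2 := @integrableD _ _ _ mu _ mU _ _ ic i1.
rewrite (@ae_eq_integral _ _ _ mu _
  (fun x => (f (tk R k))%:E + (lambda f k)%:E * (ln (radius x))%:E)%E _ mU); first 1 last.
- apply/measurable_EFinP; apply: measurable_funD.
    (* [h] agrees with [f] on [0, +oo[ and is measurable on the whole line *)
    rewrite /gamma; pose g := f \_ `]0, +oo[ ; pose h t := g t + f 0 * \1_(`]-oo, 0]) t.
    have mf : measurable_fun (`]0, +oo[ : set R) f.
      apply: open_continuous_measurable_fun; first exact: interval_open.
      move=> t; rewrite inE /= in_itv/= andbT => t0; apply: differentiable_continuous.
      exact/derivable1_diffP/df.
    have mh : measurable_fun setT h.
      apply: measurable_funD.
        have mi : measurable (`](0 : R), +oo[%classic : set R) by exact: measurable_itv.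
        by apply/(measurable_restrict _ mi measurableT); rewrite setTI.
      have mi : measurable (`]-oo, (0 : R)]%classic : set R) by exact: measurable_itv.
      by apply: measurable_funM => //; exact: (measurable_indic mi).
    rewrite (_ : (fun x => _) = fun x => h (mxnorm (D x))); last first.
      apply/funext => x; rewrite /h /g patchE indicE !mem_setE !in_itv/= andbT.
      have : 0 <= mxnorm (D x) by exact: sqrtr_ge0.
      move: (mxnorm (D x)) => t.
      by case: (ltgtP 0 t) => [_ _|//|<- _]; rewrite ?mulr0 ?mulr1 ?addr0 ?add0r.
    apply: measurableT_comp => //.
    rewrite (_ : (fun x => _) = (fun t => Num.sqrt t) \o (fun x => mxdot (D x) (D x)))//.
    apply: measurableT_comp.
      by apply: continuous_measurable_fun; exact: sqrt_continuous.
    under eq_fun do rewrite mxdot_M.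
    by apply: measurable_funD; apply: measurable_funD; apply: measurable_funM; exact: mD.
  under eq_fun do rewrite det_mx2.
  apply: measurable_funM.
    apply: measurable_funM => //.
    by have /measurable_EFinP := measurable_int mu il.
  by apply: measurable_funB; apply: measurable_funM; exact: mD.
- exact: (measurable_int mu i2).
- apply: (ae_and DE (ae_plane_neq0 R)) => x h x0 xr.
  by rewrite h// /gamma mxnorm_gradubar// det_gradubar// mulr1 EFinD EFinM.
exact: (@integrable_fin_num _ _ _ mu _ mU _ i2).
Qed.

End energy_finite.

(** * Weak gradients on the disk and passage to the limit in W_0^{1,2} *)

Section minimisation.
Variable R : realType.
Notation mu := (plane_measure R).
Variable r : R.
Hypothesis r0 : 0 < r.
Let U : set (R * R) := disk r.
Implicit Types (u v w : R * R -> 'cV[R]_2) (D W : R * R -> 'M[R]_2).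

Let mU : measurable U. Proof. exact: measurable_disk. Qed.
Let finU : (mu U < +oo)%E. Proof. exact/measure_disk_fin/ltW. Qed.

Lemma weak_grad_L2field u D : is_weak_grad U u D -> L2field U D.
Proof. by move=> uD i j; have [] := uD i j. Qed.

(** The difference of two weak derivatives is orthogonal to all test functions. *)
Lemma weak_grad_unique u D W : is_weak_grad U u D -> is_weak_grad U u W ->
  {ae mu, forall x, U x -> D x = W x}.
Proof.
move=> uD uW.
have ij i j : {ae mu, forall x, U x -> D x i j = W x i j}.
  have [DL Dp] := uD i j; have [WL Wp] := uW i j.
  have : {ae mu, forall x, U x -> D x i j - W x i j = 0}.
    apply: (@ae_eq0_of_tests _ U); first exact: open_disk.
      exact: (inL2_1 mU finU (inL2B mU DL WL)).
    move=> phi tphi; have tL := inL2_test mU finU tphi.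
    under eq_integral do rewrite mulrBl.
    apply: (integral_sub_eq0 (inL2M mU DL tL) (inL2M mU WL tL)).
    by have := Dp _ tphi; rewrite (Wp _ tphi) => /oppe_inj.
  by move=> a; apply: (ae_imp a) => x /[apply]; exact: subr0_eq.
have c := ae_and (ij ord0 ord0) (ij ord0 ord_max) (fun x p q => conj p q).
have d := ae_and (ij ord_max ord0) (ij ord_max ord_max) (fun x p q => conj p q).
apply: (ae_and c d) => x [p q] [s t] Ux; apply/matrixP.
apply: (@I2P (fun i => forall j, D x i j = W x i j)).
  by apply: (@I2P (fun j => D x ord0 j = W x ord0 j)); auto.
by apply: (@I2P (fun j => D x ord_max j = W x ord_max j)); auto.
Qed.

Lemma W12_weak_grad u : W12 U u -> is_weak_grad U u (grad U u).
Proof. by move=> [_ eD]; exact: (xgetPex (fun=> 0) eD). Qed.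

Lemma weak_gradB u v D W : (forall i, inL2 U (fun x => u x i ord0)) ->
  (forall i, inL2 U (fun x => v x i ord0)) ->
  is_weak_grad U u D -> is_weak_grad U v W ->
  is_weak_grad U (fun x => u x - v x) (fun x => D x - W x).
Proof.
move=> uL vL uD vW i j; have [DL Dp] := uD i j; have [WL Wp] := vW i j.
split; first by under eq_fun do rewrite !mxE; exact: inL2B.
move=> phi tphi; have tL := inL2_test mU finU tphi.
have dL := inL2_test mU finU (test_fun_derive j tphi).
have sub (p q s : R * R -> R) : inL2 U p -> inL2 U q -> inL2 U s ->
    (\int[mu]_(x in U) ((p x - q x) * s x)%:E =
     \int[mu]_(x in U) (p x * s x)%:E - \int[mu]_(x in U) (q x * s x)%:E)%E.
  move=> pL qL sL.
  rewrite -(@integralB _ _ _ mu _ mU _ _ (inL2M mU pL sL) (inL2M mU qL sL)).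
  by apply: eq_integral => x _; rewrite -EFinB mulrBl.
transitivity (\int[mu]_(x in U) ((u x i ord0 - v x i ord0) * 'D_(base R j) phi x)%:E)%E.
  by apply: eq_integral => x _; rewrite !mxE.
rewrite sub// (Dp _ tphi) (Wp _ tphi).
transitivity (- \int[mu]_(x in U) ((D x i j - W x i j) * phi x)%:E)%E; last first.
  by congr (- _)%E; apply: eq_integral => x _; rewrite !mxE.
rewrite sub//.
have f1 := @integrable_fin_num _ _ _ mu _ mU _ (inL2M mU DL tL).
have f2 := @integrable_fin_num _ _ _ mu _ mU _ (inL2M mU WL tL).
by rewrite -(fineK f1) -(fineK f2) -!EFinN -!EFinD opprD.
Qed.

Lemma L2field_classical_grad phi : test_field U phi -> L2field U (classical_grad phi).
Proof.
move=> tphi i j; under eq_fun do rewrite mxE.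
exact/(inL2_test mU finU)/test_fun_derive/tphi.
Qed.

Lemma L2field_gradubar k : L2field U (@gradubar R k).
Proof. exact/weak_grad_L2field/weak_grad_ubar. Qed.

Lemma W12_ubar k : W12 U (@ubar R k).
Proof.
by split => [i|]; [exact: ubar_inL2|exists (gradubar k); exact: weak_grad_ubar].
Qed.

Lemma grad_ubar_ae k : {ae mu, forall x, U x -> grad U (@ubar R k) x = gradubar k x}.
Proof. exact: (weak_grad_unique (W12_weak_grad (W12_ubar k)) (weak_grad_ubar k r0)). Qed.

(** The right-hand side is k times the scalar product of [W x] with the cofactor
    matrix of [gradubar k x]. *)
Lemma Qform_gradubarE k W (x : R * R) : x != 0 -> Qform k (gradubar k) W x =
  k%:R * ((gradubar k x ord0 ord0 * W x ord_max ord_max -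
           gradubar k x ord0 ord_max * W x ord_max ord0) -
          (gradubar k x ord_max ord0 * W x ord0 ord_max -
           gradubar k x ord_max ord_max * W x ord0 ord0)).
Proof.
move=> x0; rewrite /Qform !mxdot_cV !dRE !dtauE (caE x0) (saE x0) !mxE /rad /tau /=.
have h1 : sa x ^+ 2 = 1 - ca x ^+ 2 by rewrite -(casa_sqr x0); ring.
move: (ca x) (sa x) (cska k x).1 (cska k x).2 (isq R k) (k%:R : R) h1 => c s C S q n h1.
move: (W x ord0 ord0) (W x ord0 ord_max) (W x ord_max ord0) (W x ord_max ord_max).
move=> W00 W01 W10 W11.
(* the components of the images of e_R and e_theta under [gradubar k x] *)
have e1 : q * (c * C + n * - s * - S) * c + q * (s * C + n * c * - S) * s = q * C * (c ^+ 2 + s ^+ 2) by ring.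
have e2 : q * (c * S + n * - s * C) * c + q * (s * S + n * c * C) * s = q * S * (c ^+ 2 + s ^+ 2) by ring.
have e3 : q * (c * C + n * - s * - S) * - s + q * (s * C + n * c * - S) * c = - (q * n * S * (c ^+ 2 + s ^+ 2)) by ring.
have e4 : q * (c * S + n * - s * C) * - s + q * (s * S + n * c * C) * c = q * n * C * (c ^+ 2 + s ^+ 2) by ring.
have cs : c ^+ 2 + s ^+ 2 = 1 by rewrite h1; ring.
rewrite e1 e2 e3 e4 cs; ring.
Qed.

(** By [Qform_gradubarE] the integrand is a combination of two expressions of the
    type treated in [weak_curl_free], with one row of [gradubar] and the derivatives
    of one component of [phi] each. *)
Lemma euler_lagrange k phi : test_field U phi ->
  (\int[mu]_(x in U) (Qform k (gradubar k) (classical_grad phi) x)%:E = 0)%E.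
Proof.
move=> tphi.
have gL := L2field_gradubar k; have pL := L2field_classical_grad tphi.
pose F (i l : 'I_2) x := gradubar k x i ord0 * classical_grad phi x l ord_max -
                         gradubar k x i ord_max * classical_grad phi x l ord0.
have iF i l : mu.-integrable U (fun x => (F i l x)%:E).
  rewrite (_ : (fun x => _) = (fun x =>
    (gradubar k x i ord0 * classical_grad phi x l ord_max)%:E -
    (gradubar k x i ord_max * classical_grad phi x l ord0)%:E)%E).
    by apply: (@integrableB _ _ _ mu _ mU); apply: inL2M.
  by apply/funext => x; rewrite -EFinB.
have F0 i l : (\int[mu]_(x in U) (F i l x)%:E = 0)%E.
  have [L0 p0] := weak_grad_ubar k r0 i ord0.
  have [L1 p1] := weak_grad_ubar k r0 i ord_max.
  rewrite -[RHS](weak_curl_free r0 L0 L1 p0 p1 (tphi l)).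
  by apply: eq_integral => x _; rewrite /F !(mxE _ _ l).
have i3 : mu.-integrable U (fun x => (F ord0 ord_max x - F ord_max ord0 x)%:E).
  rewrite (_ : (fun x => _) = (fun x => (F ord0 ord_max x)%:E - (F ord_max ord0 x)%:E)%E).
    exact: (@integrableB _ _ _ mu _ mU).
  by apply/funext => x; rewrite -EFinB.
have i4 := @integrableZl _ _ _ mu _ mU k%:R _ i3.
rewrite (@ae_eq_integral _ _ _ mu _
   (fun x => k%:R%:E * (F ord0 ord_max x - F ord_max ord0 x)%:E)%E _ mU).
- rewrite (@integralZl _ _ _ mu _ mU _ i3) (integral_sub_eq0) ?mule0//.
  by rewrite !F0.
- exact: (measurable_int mu (Qform_integrable mU k gL pL)).
- exact: (measurable_int mu i4).
- apply: (ae_imp (ae_plane_neq0 R)) => x x0 _.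
  by rewrite -EFinM Qform_gradubarE.
Qed.

(** Real-valued integrals over the disk, so that estimates can be combined by
    linear arithmetic. *)
Definition RI (F : R * R -> R) : R := fine (\int[mu]_(x in U) (F x)%:E)%E.

Definition intg (F : R * R -> R) : Prop := mu.-integrable U (fun x => (F x)%:E).

Lemma RIE F : intg F -> (\int[mu]_(x in U) (F x)%:E = (RI F)%:E)%E.
Proof. by move=> iF; rewrite /RI fineK//; exact: (@integrable_fin_num _ _ _ mu _ mU _ iF). Qed.

Lemma intgD F H : intg F -> intg H -> intg (fun x => F x + H x).
Proof.
move=> iF iH; rewrite /intg (_ : (fun x => _) = (fun x => (F x)%:E + (H x)%:E)%E).
  exact: (@integrableD _ _ _ mu _ mU).
by apply/funext => x; rewrite EFinD.
Qed.

Lemma intgZ c F : intg F -> intg (fun x => c * F x).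
Proof.
move=> iF; rewrite /intg (_ : (fun x => _) = (fun x => c%:E * (F x)%:E)%E).
  exact: (@integrableZl _ _ _ mu _ mU).
by apply/funext => x; rewrite EFinM.
Qed.

Lemma RI_D F H : intg F -> intg H -> RI (fun x => F x + H x) = RI F + RI H.
Proof.
move=> iF iH; apply: EFin_inj; rewrite EFinD -!RIE//; last exact: intgD.
under eq_integral do rewrite EFinD.
exact: (@integralD _ _ _ mu _ mU).
Qed.

Lemma RI_Z c F : intg F -> RI (fun x => c * F x) = c * RI F.
Proof.
move=> iF; apply: EFin_inj; rewrite EFinM -!RIE//; last exact: intgZ.
under eq_integral do rewrite EFinM.
exact: (@integralZl _ _ _ mu _ mU).
Qed.

Lemma RI_le F H : intg F -> intg H -> (forall x, U x -> F x <= H x) -> RI F <= RI H.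
Proof.
move=> iF iH FH; rewrite -lee_fin -!RIE//.
by apply: (@le_integral _ _ _ mu) => // x; rewrite inE => xU; rewrite lee_fin FH.
Qed.

Lemma RI_ge0 F : (forall x, U x -> 0 <= F x) -> 0 <= RI F.
Proof. by move=> F0; apply: fine_ge0; apply: integral_ge0 => x xU; rewrite lee_fin F0. Qed.

Lemma RI_norm_le F H : intg F -> intg H -> (forall x, U x -> `|F x| <= H x) ->
  `|RI F| <= RI H.
Proof.
move=> iF iH FH; rewrite ler_norml; apply/andP; split.
  rewrite -[- _]mulN1r -(RI_Z _ iH); apply: RI_le => //; first exact: intgZ.
  by move=> x /FH; rewrite mulN1r ler_norml => /andP[].
by apply: RI_le => // x /FH; rewrite ler_norml => /andP[].
Qed.

Lemma mxnorm_cV_intg v : (forall i, inL2 U (fun x => v x i ord0)) ->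
  intg (fun x => mxnorm (v x) ^+ 2).
Proof.
move=> vL; rewrite /intg; under eq_fun do rewrite mxnorm_sqr mxdot_cV.
by apply: intgD; exact: inL2M.
Qed.

Lemma mxnorm_M_intg D : L2field U D -> intg (fun x => mxnorm (D x) ^+ 2).
Proof.
move=> DL; rewrite /intg; under eq_fun do rewrite mxnorm_sqr mxdot_M.
by apply: intgD; apply: intgD; exact: inL2M.
Qed.

Section approximation.
Variables (w : R * R -> 'cV[R]_2) (phi : nat -> R * R -> 'cV[R]_2).
Hypothesis w12 : W12 U w.
Hypothesis tphi : forall n, test_field U (phi n).
Hypothesis wphi : (\int[mu]_(x in U)
       (mxnorm (w x - phi n x) ^+ 2 +
        mxnorm (grad U w x - classical_grad (phi n) x) ^+ 2)%:E)%E
      @[n --> \oo] --> 0%E.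
Let W := grad U w.

Let err n x := mxnorm (w x - phi n x) ^+ 2 + mxnorm (W x - classical_grad (phi n) x) ^+ 2.

Let WL : L2field U W. Proof. exact/weak_grad_L2field/W12_weak_grad. Qed.

Let wL i : inL2 U (fun x => w x i ord0). Proof. by have [+ _] := w12; exact. Qed.

Let gL n : L2field U (classical_grad (phi n)).
Proof. exact: L2field_classical_grad. Qed.

Let ia n : intg (fun x => mxnorm (w x - phi n x) ^+ 2).
Proof.
apply: mxnorm_cV_intg => i; under eq_fun do rewrite !mxE.
by apply: inL2B => //; apply: inL2_test => //; exact: tphi.
Qed.

Let ib n : intg (fun x => mxnorm (W x - classical_grad (phi n) x) ^+ 2).
Proof. by apply: mxnorm_M_intg; exact: L2fieldB. Qed.

Lemma err_small (e : R) : 0 < e -> exists n, RI (err n) < e.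
Proof.
move=> e0; have [_ /cvgrPdist_lt/(_ _ e0)] := (fine_cvgP _ _).1 wphi.
move=> [n _ h]; exists n; have := h n (leqnn n).
by rewrite /= sub0r normrN; apply: le_lt_trans; exact: ler_norm.
Qed.

(** The cross term is continuous in the gradient for the L^2 norm and vanishes on
    test fields. *)
Lemma Qform_W012_orthogonal k : (\int[mu]_(x in U) (Qform k (gradubar k) W x)%:E = 0)%E.
Proof.
have ubL := L2field_gradubar k.
have iQ := Qform_integrable mU k ubL WL.
have iA := Qform_integrable mU k ubL ubL.
rewrite (RIE iQ); congr (_%:E); set al := RI _.
apply/eqP; apply: contrapT => /negP al0.
pose A := RI (Qform k (gradubar k) (gradubar k)).
have A0 : 0 <= A by apply: RI_ge0 => x _; exact: Qform_ge0.
have n0 : 0 < `|al| by rewrite normr_gt0.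
(* with this e the first term of Young's inequality is at most |al| / 2; the error below keeps the second one under |al| / 4 *)
pose e := `|al| / (A + 1).
have A1 : 0 < A + 1 by rewrite ltr_wpDl.
have e0 : 0 < e by rewrite divr_gt0.
pose c : R := k%:R ^+ 2 + 1.
have c0 : 0 < c by rewrite ltr_wpDl// sqr_ge0.
have [n en] : exists n, RI (err n) < `|al| * e / (2 * c).
  by apply: err_small; rewrite divr_gt0// mulr_gt0.
pose Z x := W x - classical_grad (phi n) x.
have ZL : L2field U Z by exact: L2fieldB.
have iZ := Qform_integrable mU k ubL ZL.
have iZZ := Qform_integrable mU k ZL ZL.
have alE : al = RI (Qform k (gradubar k) Z).
  have ig := Qform_integrable mU k ubL (gL n).
  have g0 : RI (Qform k (gradubar k) (classical_grad (phi n))) = 0.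
    by rewrite /RI euler_lagrange.
  rewrite -[RHS]addr0 -g0 -RI_D//; congr (fine _); apply: eq_integral => x _.
  by rewrite -QformDr /Z; congr (_%:E); rewrite /Qform /dR /dtau subrK.
have h1 : `|al| <= e / 2 * A + (2 * e)^-1 * RI (Qform k Z Z).
  rewrite {1}alE -RI_Z// -RI_Z// -RI_D; try exact: intgZ.
  apply: RI_norm_le => //; first by apply: intgD; exact: intgZ.
  by move=> x _; exact: Qform_norm_le.
have h2 : RI (Qform k Z Z) <= c * RI (err n).
  rewrite -RI_Z; last exact: intgD.
  apply: RI_le => //; first by apply/intgZ/intgD.
  move=> x _; apply: (le_trans (Qform_le k Z x)).
  by apply: ler_wpM2l; [exact: ltW|rewrite /err lerDr sqr_ge0].
have h3 : (2 * e)^-1 * RI (Qform k Z Z) <= `|al| / 4.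
  apply: (@le_trans _ _ ((2 * e)^-1 * (c * (`|al| * e / (2 * c))))).
    apply: ler_wpM2l; first by rewrite invr_ge0 mulr_ge0// ltW.
    by apply: (le_trans h2); apply: ler_wpM2l; exact: ltW.
  rewrite le_eqVlt; apply/orP; left; apply/eqP; field.
  by rewrite !gt_eqF.
have h4 : e * A <= `|al| by rewrite /e mulrAC ler_pdivrMr// ler_wpM2l// lerDl.
lra.
Qed.

(** The inequality for test fields passes to the limit, up to a constant: [w] and
    its gradient differ from those of [phi n] by an error that tends to 0. *)
Lemma W012_poincare k : (1 <= k)%N ->
  RI (fun x => mxnorm (w x) ^+ 2) <= 16 * r ^+ 2 * RI (Qform k W W).
Proof.
move=> k1; apply/ler_addgt0Pr => e e0.
pose c : R := 2 + 16 * r ^+ 2.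
have c0 : 0 < c by rewrite ltr_pwDl// mulr_ge0// sqr_ge0.
have [n en] : exists n, RI (err n) < e / c by apply: err_small; rewrite divr_gt0.
have tL i : inL2 U (fun x => phi n x i ord0).
  by apply: inL2_test => //; exact: tphi.
have dL i : inL2 U (fun x => classical_grad (phi n) x i ord0) := gL n i ord0.
pose d x := classical_grad (phi n) x ord0 ord0 ^+ 2 +
            classical_grad (phi n) x ord_max ord0 ^+ 2.
have i2 i : intg (fun x => phi n x i ord0 ^+ 2) by have [] := tL i.
have i3 i : intg (fun x => classical_grad (phi n) x i ord0 ^+ 2) by have [] := dL i.
have id : intg d by exact: intgD.
have ip : intg (fun x => mxnorm (phi n x) ^+ 2) by exact: mxnorm_cV_intg.
have iQ := Qform_integrable mU k WL WL.
have p1 : RI (fun x => mxnorm (phi n x) ^+ 2) <= 4 * r ^+ 2 * RI d.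
  have pe : (fun x => mxnorm (phi n x) ^+ 2) =
      (fun x => phi n x ord0 ord0 ^+ 2 + phi n x ord_max ord0 ^+ 2).
    by apply/funext => x; rewrite mxnorm_sqr mxdot_cV -!expr2.
  rewrite pe RI_D// RI_D// mulrDr.
  have pi i : RI (fun x => phi n x i ord0 ^+ 2) <=
      4 * r ^+ 2 * RI (fun x => classical_grad (phi n) x i ord0 ^+ 2).
    rewrite -lee_fin EFinM -!RIE//; apply: le_trans (poincare_test r0 (tphi n i)) _.
    by rewrite le_eqVlt; apply/orP; left; apply/eqP; congr (_ * _)%E;
      apply: eq_integral => x _; rewrite mxE.
  exact: lerD.
have p2 : RI d <= 2 * RI (err n) + 2 * RI (Qform k W W).
  rewrite -RI_Z; last exact: intgD.
  rewrite -RI_Z// -RI_D; [|exact/intgZ/intgD|exact: intgZ].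
  apply: RI_le => //; first by apply: intgD; [exact/intgZ/intgD|exact: intgZ].
  move=> x _; have q := Qform_ge_mxnorm W x k1.
  have h : d x <= 2 * mxnorm (W x - classical_grad (phi n) x) ^+ 2 + 2 * mxnorm (W x) ^+ 2.
    rewrite !mxnorm_sqr !mxdot_M /d.
    move: (classical_grad (phi n) x) (W x) => B A; rewrite !mxE.
    have y (a b : R) : b ^+ 2 <= 2 * ((a - b) * (a - b)) + 2 * (a * a).
      by have := sqr_ge0 (2 * a - b); nra.
    have y0 (a : R) : 0 <= a * a by rewrite -expr2 sqr_ge0.
    have := y (A ord0 ord0) (B ord0 ord0); have := y (A ord_max ord0) (B ord_max ord0).
    have := y0 (A ord0 ord_max - B ord0 ord_max).
    have := y0 (A ord_max ord_max - B ord_max ord_max).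
    by have := y0 (A ord0 ord_max); have := y0 (A ord_max ord_max); lra.
  apply: (le_trans h); rewrite lerD ?ler_wpM2l// /err lerDr sqr_ge0//.
have p3 : RI (fun x => mxnorm (w x) ^+ 2) <=
    2 * RI (err n) + 2 * RI (fun x => mxnorm (phi n x) ^+ 2).
  rewrite -RI_Z; last exact: intgD.
  rewrite -RI_Z// -RI_D; [|exact/intgZ/intgD|exact: intgZ].
  apply: RI_le; first exact: mxnorm_cV_intg.
    by apply: intgD; [exact/intgZ/intgD|exact: intgZ].
  move=> x _.
  have h : mxnorm (w x) ^+ 2 <= 2 * mxnorm (w x - phi n x) ^+ 2 + 2 * mxnorm (phi n x) ^+ 2.
    rewrite !mxnorm_sqr !mxdot_cV !mxE.
    have y (a b : R) : a * a <= 2 * ((a - b) * (a - b)) + 2 * (b * b).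
      by have := sqr_ge0 (a - 2 * b); nra.
    have := y (w x ord0 ord0) (phi n x ord0 ord0).
    by have := y (w x ord_max ord0) (phi n x ord_max ord0); lra.
  by apply: (le_trans h); rewrite lerD2r ler_wpM2l// /err lerDl sqr_ge0.
have en' : c * RI (err n) <= e by rewrite mulrC -ler_pdivlMr// ltW.
have r2 : 0 <= r ^+ 2 by rewrite sqr_ge0.
have p4 : r ^+ 2 * RI d <= r ^+ 2 * (2 * RI (err n) + 2 * RI (Qform k W W)).
  by rewrite ler_wpM2l.
move: p1 p3 p4 en'; rewrite /c.
move: (RI _) (RI _) (RI _) (RI _) (RI _) => *; lra.
Qed.

End approximation.

End minimisation.

(** * Minimality and uniqueness *)

Section conclusion.
Variable R : realType.
Notation mu := (plane_measure R).
Variables (r : R) (k : nat) (f : R -> R).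
Hypothesis r0 : 0 < r.
Hypothesis k_ge2 : (2 <= k)%N.
Hypothesis df : forall t : R, 0 < t -> derivable f t 1.
Notation U := (disk r).

Let mU : measurable U. Proof. exact: measurable_disk. Qed.
Let k0 : (0 < k)%N. Proof. exact: ltnW. Qed.
Let ubW := W12_ubar r0 k.
Let gL := L2field_gradubar r0 k.

Lemma E_Qform u : E k r u = (\int[mu]_(x in U) (Qform k (grad U u) (grad U u) x)%:E)%E.
Proof. by apply: eq_integral => x _; rewrite /Qform !mxnorm_sqr. Qed.

Lemma E_ubar : E k r (@ubar R k) =
  (\int[mu]_(x in U) (Qform k (gradubar k) (gradubar k) x)%:E)%E.
Proof.
have DL := weak_grad_L2field (W12_weak_grad ubW).
by rewrite E_Qform; apply: (integral_Qform_eq mU) => //; exact: grad_ubar_ae.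
Qed.

(** This representative of the gradient of u - ubar, unlike the chosen one, is
    related pointwise to the gradient of u. *)
Lemma weak_grad_subr_ubar u : W12 U u ->
  is_weak_grad U (fun x => u x - ubar k x) (fun x => grad U u x - gradubar k x).
Proof.
move=> uW; have [uL _] := uW.
apply: weak_gradB => //; first by move=> i; exact: ubar_inL2.
  exact: W12_weak_grad.
exact: weak_grad_ubar.
Qed.

(** The boundary condition holds with the zero sequence of test fields. *)
Lemma A2_ubar : A2 f k r (@ubar R k).
Proof.
have gz := weak_grad_subr_ubar ubW.
have zW : W12 U (fun x => ubar k x - ubar k x).
  split; last by exists (fun x => grad U (@ubar R k) x - gradubar k x).
  move=> i; under eq_fun do rewrite subrr mxE.
  by apply: (inL2_test mU (measure_disk_fin (ltW r0))); exact: test_fun0.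
have DL := weak_grad_L2field (W12_weak_grad ubW).
have zL := weak_grad_L2field (W12_weak_grad zW).
split => //.
- split => //; exists (fun _ _ => 0); split.
    by move=> n i; rewrite (_ : (fun x => _) = fun=> 0); [exact: test_fun0|apply/funext => x; rewrite mxE].
  rewrite (_ : (fun n => _) = cst 0%E); first exact: cvg_cst.
  apply/funext => n /=.
  have cg x : classical_grad (fun _ => 0 : 'cV[R]_2) x = 0.
    by apply/matrixP => i j; rewrite !mxE; exact: derive_cst.
  have iz : mu.-integrable U (fun x => (mxnorm (grad U (fun x => ubar k x - ubar k x) x) ^+ 2)%:E).
    exact: (mxnorm_M_intg zL).
  rewrite (@ae_eq_integral _ _ _ mu _ (cst 0%E) _ mU).
  + by rewrite integral0.
  + under eq_fun do rewrite cg !subr0 subrr mxnorm0 expr0n add0r.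
    exact: (measurable_int mu iz).
  + exact: measurable_cst.
  + apply: (ae_and (weak_grad_unique r0 (W12_weak_grad zW) gz) (grad_ubar_ae r0 k)) => x h1 h2 Ux.
    rewrite cg !subr0 subrr h1// h2// subrr.
    by rewrite !mxnorm0 expr0n addr0.
- have := G_fin_num (f := f) r0 k0 df DL (grad_ubar_ae r0 k).
  by rewrite fin_numElt.
Qed.

(** The Pythagorean identity of the quadratic form: the cross term vanishes. *)
Lemma E_decomposition u : W12 U u -> W012 U (fun x => u x - ubar k x) ->
  let W := grad U (fun x => u x - ubar k x) in
  (E k r u = E k r (@ubar R k) + \int[mu]_(x in U) (Qform k W W x)%:E)%E.
Proof.
move=> uW [wW [phi [tphi wphi]]] W.
have DL := weak_grad_L2field (W12_weak_grad uW).
have WL : L2field U W := weak_grad_L2field (W12_weak_grad wW).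
have aeW : {ae mu, forall x, U x -> grad U u x = gradubar k x + W x}.
  apply: (ae_imp (weak_grad_unique r0 (W12_weak_grad wW) (weak_grad_subr_ubar uW))) => x h Ux.
  by rewrite /W h// addrC subrK.
rewrite E_Qform E_ubar.
transitivity (\int[mu]_(x in U) (Qform k (fun x => gradubar k x + W x)%R
    (fun x => gradubar k x + W x)%R x)%:E)%E.
  by apply: (integral_Qform_eq mU) => //; exact: L2fieldD.
rewrite (integral_Qform_sqrD mU)// (Qform_W012_orthogonal r0 wW tphi wphi k).
by rewrite mule0 adde0.
Qed.

Lemma ubar_minimizer : global_minimizer (@E R k r) (A2 f k r) (@ubar R k).
Proof.
split; first exact: A2_ubar.
move=> v [vW v0 _]; rewrite (E_decomposition vW v0) leeDl//.
by apply: integral_ge0 => x _; rewrite lee_fin Qform_ge0.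
Qed.

(** A second minimiser has the same energy, so its difference with [ubar] has energy
    0 and vanishes by the Poincare inequality. *)
Lemma minimizer_unique u : global_minimizer (@E R k r) (A2 f k r) u ->
  {ae mu, forall x, U x -> u x = ubar k x}.
Proof.
move=> [[uW u0 _] /(_ _ A2_ubar)]; rewrite (E_decomposition uW u0).
have [wW [phi [tphi wphi]]] := u0.
set W := grad U _; have WL : L2field U W := weak_grad_L2field (W12_weak_grad wW).
have iW := Qform_integrable mU k WL WL.
have iA := Qform_integrable mU k gL gL.
have fA := @integrable_fin_num _ _ _ mu _ mU _ iA.
rewrite E_ubar (RIE iW) -(fineK fA) -EFinD lee_fin gerDl => Q0.
have [wL _] := wW.
have iw := mxnorm_cV_intg wL.
have : RI r (fun x => mxnorm (u x - ubar k x) ^+ 2) <= 0.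
  apply: (le_trans (W012_poincare r0 wW tphi wphi k0)).
  by rewrite mulr_ge0_le0// mulr_ge0// sqr_ge0.
move=> w0.
have : ae_eq mu U (fun x => (mxnorm (u x - ubar k x) ^+ 2)%:E) (cst 0%E).
  apply/(@ae_eq_integral_abs _ _ _ mu _ mU); first exact: (measurable_int mu iw).
  under eq_integral do rewrite gee0_abs ?lee_fin ?sqr_ge0//.
  rewrite (RIE iw); congr (_%:E); apply/eqP; rewrite eq_le w0/=.
  by apply: RI_ge0 => x _; exact: sqr_ge0.
move=> ae0; apply: (ae_imp ae0) => x h Ux; have := h Ux.
move: (u x) (ubar k x) => a b -[]; rewrite mxnorm_sqr mxdot_cV -!expr2 !mxE => /eqP.
rewrite paddr_eq0 ?sqr_ge0// !sqrf_eq0 !subr_eq0 => /andP[/eqP p /eqP q].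
by apply/colP; exact: (@I2P (fun i => a i 0 = b i 0) p q).
Qed.

Lemma ubar_euler_lagrange phi : test_field U phi ->
  (\int[mu]_(x in U)
     (mxdot (dtau (grad U (@ubar R k)) x) (dtau (classical_grad phi) x) +
      k%:R ^+ 2 * mxdot (dR (grad U (@ubar R k)) x) (dR (classical_grad phi) x))%:E
   = 0)%E.
Proof.
move=> tphi; rewrite -[RHS](euler_lagrange r0 k tphi).
under eq_integral do rewrite addrC.
have DL := weak_grad_L2field (W12_weak_grad ubW).
have pL := L2field_classical_grad r0 tphi.
apply: (integral_Qform_eq mU) => //; first exact: grad_ubar_ae.
by apply: (ae_imp (ae_plane_neq0 R)).
Qed.

End conclusion.

Unset Implicit Arguments.
Set Strict Implicit.
Set Printing Implicit Defensive.

Theorem proposition4p2 (R : realType) (r : R) (k : nat) (f : R -> R)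
    (c1 c2 : R)
    (r_gt0 : 0 < r) (k_ge2 : (2 <= k)%N)
    (f_C2 : forall t : R, 0 < t ->
       [/\ derivable f t 1, derivable (derive1 f) t 1 & {for t, continuous (derive1n 2 f)}])
    (f_convex : forall t : R, 0 < t -> 0 < derive1n 2 f t)
    (gamma_diff0 : differentiable (gamma f) (0 : 'M[R]_2))
    (gamma0 : gamma f 0 = 0)
    (gamma_ge0 : forall F : 'M[R]_2, gamma f 0 <= gamma f F)
    (c1_gt0 : 0 < c1) (c2_gt0 : 0 < c2)
    (gamma_growth : forall F : 'M[R]_2,
       c1 * mxnorm F ^+ 2 <= gamma f F <= c2 * (1 + mxnorm F ^+ 2)) :
  (forall phi : R * R -> 'cV[R]_2, test_field (disk r) phi ->
     (\int[plane_measure R]_(x in disk r)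
        (mxdot (dtau (grad (disk r) (@ubar R k)) x) (dtau (classical_grad phi) x) +
         k%:R ^+ 2 *
         mxdot (dR (grad (disk r) (@ubar R k)) x) (dR (classical_grad phi) x))%:E
      = 0)%E) /\
  global_minimizer (@E R k r) (A2 f k r) (@ubar R k) /\
  (forall u, global_minimizer (@E R k r) (A2 f k r) u ->
     {ae plane_measure R, forall x, disk r x -> u x = ubar k x}).
Proof.
have df (t : R) : 0 < t -> derivable f t 1 by move=> /f_C2[].
split; first by move=> phi tphi; exact: ubar_euler_lagrange.
split; first exact: (ubar_minimizer r_gt0 k_ge2 df).
by move=> u; exact: (minimizer_unique r_gt0 k_ge2 df).
Qed.
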